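(* Let $\kappa$ be a cardinal satisfying $cf(\kappa)>\omega_1$. If $X$ is a nonreflexive Grothendieck space of density $\kappa$, then $X$ does not admit an overcomplete set.
   Context: All Banach spaces are infinite dimensional and over the reals. $dens(X)$ (the density) is the minimal cardinality of a norm dense subset of $X$; $cf(\kappa)$ is the cofinality of $\kappa$. A subset $Y$ of a Banach space $X$ is called overcomplete (in $X$) if $|Y|=dens(X)$ and every $Z\subseteq Y$ with $|Z|=|Y|$ is linearly dense in $X$ (its linear span is norm dense in $X$). A Banach space $X$ is a Grothendieck space if weakly$^*$ convergent sequences in $X^*$ coincide with weakly convergent sequences. *)

(* Defs.v *)
From HB Require Import structures.
From mathcomp Require Import all_boot all_order all_algebra.
From mathcomp Require Import all_classical all_reals topology normedtype.
From mathcomp Require wochoice.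

Set Implicit Arguments.
Unset Strict Implicit.
Unset Printing Implicit Defensive.

Import Order.TTheory GRing.Theory Num.Theory.
Import numFieldNormedType.Exports.

Local Open Scope classical_set_scope.
Local Open Scope ring_scope.
Local Open Scope card_scope.

Definition card_lt T U (A : set T) (B : set U) : Prop := A #<= B /\ ~~ (A #= B).
Notation "A '#<' B" := (card_lt A B)
  (at level 79, format "A  '#<'  B") : card_scope.

Lemma ex_card_min (I : Type) (T : I -> Type) (A : forall i, set (T i)) :
  inhabited I -> exists i, forall j, A i #<= A j.
Proof.
move=> [i0].
pose P (M : set (forall i, T i)) := (forall f i, M f -> A i (f i)) /\
  (forall f g i, M f -> M g -> f i = g i -> f = g).
have [G GP tot|M [[MA Minj] Mmax]] := @Zorn_bigcup _ P.
  split=> [f i [M GM Mf]|f g i [M GM Mf] [N GN Ng]].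
    by have [+ _] := GP _ GM; apply.
  have [MN|NM] := tot _ _ GM GN.
    by have [_] := GP _ GN; apply=> //; exact: MN.
  by have [_] := GP _ GM; apply=> //; exact: NM.
have [[i onA]|noA] := pselect (exists i,
    forall a, A i a -> exists2 f, M f & f i = a).
  exists i => j; have -> : A i = (fun f => f i) @` M.
    apply/seteqP; split=> [a /onA[f ? ?]|_ [f Mf <-]]; first by exists f.
    exact: MA.
  have Mj : (fun f => f j) @` M #= M.
    by apply: inj_card_eq => f g /set_mem Mf /set_mem Mg; exact: Minj.
  apply: card_le_trans (card_image_le _ _) _.
  by rewrite -(card_le_eql Mj); apply: subset_card_le => _ [f Mf <-]; exact: MA.
have out i : exists a, A i a /\ forall f, M f -> f i <> a.
  apply: contrapT => na; apply: noA; exists i => a Aa.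
  apply: contrapT => nf; apply: na; exists a; split=> // f Mf fi.
  by apply: nf; exists f.
pose g i := projT1 (cid (out i)).
have gA i : A i (g i) by case: (projT2 (cid (out i))).
have gM i f : M f -> f i <> g i by case: (projT2 (cid (out i))) => _; apply.
exfalso; apply: (Mmax (M `|` [set g])); last first.
  split=> [f i [/MA//|->//]|f f' i [Mf|->] [Mf'|->] // E].
  - exact: Minj E.
  - by case: (gM i f).
  - by case: (gM i f').
split=> [|/(_ g (or_intror erefl)) Mg]; first by move=> f; left.
exact: gM i0 _ Mg erefl.
Qed.

(* "The minimal cardinality of a member of F", cardinals being taken up to #=:
   a member of F of minimal cardinality. By least_cardP, the default value of
   get is only used when F is empty. *)
Definition least_card T (F : set (set T)) : set T :=
  get [set A | F A /\ forall B, F B -> A #<= B].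

Lemma least_cardP T (F : set (set T)) : F !=set0 ->
  F (least_card F) /\ forall B, F B -> least_card F #<= B.
Proof.
move=> [A0 FA0].
have [[A FA] Amin] := @ex_card_min {A | F A} (fun=> T) (fun A => sval A)
  (inhabits (exist _ A0 FA0)).
apply: (@getPex _ [set A | F A /\ forall B, F B -> A #<= B]).
by exists A; split=> // B FB; exact: (Amin (exist _ B FB)).
Qed.

(* A set of cardinality aleph_1: minimal among the uncountable sets of sets of
   naturals, hence, by omega1_le, among the uncountable sets of any type. *)
Definition omega1 : set (set nat) :=
  least_card [set A : set (set nat) | ~ countable A].

Lemma ex_uncountable : [set A : set (set nat) | ~ countable A] !=set0.
Proof.
exists setT => /= /pcard_injP[f /in2TT finj].
pose D := [set n | exists2 A : set nat, f A = n & ~ A n].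
have nD : ~ D (f D) by move=> /[dup] DD [A /finj->].
by apply: (nD); exists D.
Qed.

Lemma omega1_uncountable : ~ countable omega1.
Proof. by have [] := least_cardP ex_uncountable. Qed.

Lemma omega1_le T (A : set T) : ~ countable A -> omega1 #<= A.
Proof.
move=> ncA.
pose S (b : bool) : Type := if b then T else set nat.
pose B (b : bool) : set (S b) := if b return set (S b) then A else omega1.
have [[] le] := @ex_card_min bool S B (inhabits true); last exact: le true.
have /card_subP[C CA _] : A #<= omega1 := le false.
have [_ omin] := least_cardP ex_uncountable.
rewrite -(card_le_eqr CA); apply: omin => /= cC.
by apply: ncA; rewrite -(eq_countable CA).
Qed.

(* A cardinal as an initial ordinal: a well-ordered set all of whose proper
   initial segments have strictly smaller cardinality. *)
Record cardinal := Cardinal {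
  card_sort :> Type ;
  card_order : rel card_sort ;
  card_order_wo : wochoice.well_order card_order ;
  card_order_initial : forall a : card_sort,
    [set b | card_order b a /\ b <> a] #< [set: card_sort] }.

Definition cofinal (kappa : cardinal) (A : set kappa) : Prop :=
  forall a, exists2 b, A b & card_order a b.

Definition cf (kappa : cardinal) : set kappa :=
  least_card [set A : set kappa | cofinal A].
Arguments cf : clear implicits.

Lemma cfP (kappa : cardinal) : cofinal (cf kappa) /\
  forall A : set kappa, cofinal A -> cf kappa #<= A.
Proof.
apply: least_cardP; exists setT => a; exists a => //.
have [|b [[/asboolP ba amin] _]] :=
  @card_order_wo kappa (fun b => `[< b = a >]); first by exists a; apply/asboolP.
by rewrite -{1}ba; apply: amin; apply/asboolP.
Qed.

Definition dens (X : topologicalType) : set X := least_card [set D | dense D].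
Arguments dens : clear implicits.

Lemma densP (X : topologicalType) : dense (dens X) /\
  forall D : set X, dense D -> dens X #<= D.
Proof. by apply: least_cardP; exists setT => O ? _; rewrite setIT. Qed.

Section span.
Variables (R : realType) (X : normedModType R).

Definition lspan (S : set X) : set X :=
  [set v | exists n (a : 'I_n -> R) (s : 'I_n -> X),
    (forall i, S (s i)) /\ v = \sum_(i < n) a i *: s i].

Definition infinite_dimensional : Prop :=
  forall S : set X, finite_set S -> lspan S <> setT.

Definition overcomplete (Y : set X) : Prop :=
  Y #= dens X /\
  forall Z : set X, Z `<=` Y -> Z #= Y -> dense (lspan Z).

End span.
Arguments infinite_dimensional {R} X.

Section dual.
Variables (R : realType) (X : normedModType R).

Definition continuous_linear : {pred X -> R^o} :=
  [pred f | `[< linear f >] && `[< continuous f >]].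

Record dual := Dual {
  dual_fun :> X -> R^o ;
  dual_funP : dual_fun \in continuous_linear }.

HB.instance Definition _ := [isSub for dual_fun].
HB.instance Definition _ := [Choice of dual by <:].

Lemma dual_continuous (f : dual) : continuous f.
Proof. by case: f => f /= /andP[_ /asboolP]. Qed.

Lemma dual_linear (f : dual) : linear f.
Proof. by case: f => f /= /andP[/asboolP]. Qed.

HB.instance Definition _ (f : dual) :=
  GRing.isLinear.Build R X R^o *:%R (dual_fun f) (@dual_linear f).

Lemma continuous_linear_submod_closed : submod_closed continuous_linear.
Proof.
split.
  apply/andP; split; apply/asboolP; last exact: cst_continuous.
  by move=> a x y; rewrite /= /GRing.zero/= scaler0 addr0.
move=> a f g /andP[/asboolP lf /asboolP cf] /andP[/asboolP lg /asboolP cg].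
apply/andP; split; apply/asboolP.
  move=> b x y; rewrite !fctE lf lg !scalerDr addrACA.
  by rewrite scalerA mulrC -scalerA.
by move=> x; apply: cvgD; [apply: cvgZr; exact: cf|exact: cg].
Qed.

HB.instance Definition _ := GRing.isSubmodClosed.Build R (X -> R^o)
  continuous_linear continuous_linear_submod_closed.
HB.instance Definition _ := [SubChoice_isSubLmodule of dual by <:].

Definition dual_norm (f : dual) : R :=
  sup [set `|f x| | x in [set x | `|x| <= 1]].

Lemma dual_norm_has_sup (f : dual) :
  has_sup [set `|f x| | x in [set x | `|x| <= 1]].
Proof.
split; first by exists `|f 0|; exists 0 => //=; rewrite normr0.
have /linear_bounded_continuous/bounded_funP/(_ 1)[M fM] := @dual_continuous f.
by exists M => _ [x /= x1 <-]; exact: fM.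
Qed.

Lemma dual_norm_ub (f : dual) x : `|f x| <= dual_norm f * `|x|.
Proof.
have [->|x0] := eqVneq x 0; first by rewrite linear0 !normr0 mulr0.
rewrite -ler_pdivrMr ?normr_gt0//.
apply: (ub_le_sup (dual_norm_has_sup f).2).
exists (`|x|^-1 *: x) => /=; last first.
  by rewrite linearZ normrZ normfV normr_id mulrC.
by rewrite normrZ normfV normr_id mulVf// normr_eq0.
Qed.

Lemma dual_norm_le (f : dual) M :
  (forall x, `|x| <= 1 -> `|f x| <= M) -> dual_norm f <= M.
Proof.
move=> fM; apply: ge_sup; first exact: (dual_norm_has_sup f).1.
by move=> _ [x /= x1 <-]; exact: fM.
Qed.

Lemma dual_norm_ge0 (f : dual) : 0 <= dual_norm f.
Proof.
apply: (ub_le_sup (dual_norm_has_sup f).2).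
by exists 0; rewrite /= ?linear0 normr0.
Qed.

Lemma ler_dual_norm (f : dual) x : `|x| <= 1 -> `|f x| <= dual_norm f.
Proof.
move=> x1; apply: (le_trans (dual_norm_ub f x)).
by rewrite ler_piMr// dual_norm_ge0.
Qed.

Lemma dual_normD (f g : dual) : dual_norm (f + g) <= dual_norm f + dual_norm g.
Proof.
apply: dual_norm_le => x x1; apply: (le_trans (ler_normD _ _)).
by apply: lerD; exact: ler_dual_norm.
Qed.

Lemma dual_normZ (a : R) (f : dual) : dual_norm (a *: f) = `|a| * dual_norm f.
Proof.
have le b g : dual_norm (b *: g) <= `|b| * dual_norm g.
  apply: dual_norm_le => x x1; rewrite [_ x]/(b *: g x) normrZ.
  by rewrite ler_wpM2l// ler_dual_norm.
apply/eqP; rewrite eq_le le/=.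
have [->|a0] := eqVneq a 0; first by rewrite normr0 mul0r dual_norm_ge0.
rewrite -ler_pdivlMl ?normr_gt0// -normfV.
by rewrite -{1}[f]scale1r -(mulVf a0) -scalerA le.
Qed.

Lemma dual_norm0_eq0 (f : dual) : dual_norm f = 0 -> f = 0.
Proof.
move=> f0; apply/val_inj/funext => x; apply/eqP.
by rewrite -normr_le0 (le_trans (dual_norm_ub f x))// f0 mul0r.
Qed.

HB.instance Definition _ := Lmodule_isNormed.Build R dual
  dual_normD dual_normZ dual_norm0_eq0.

End dual.
Arguments dual {R} X.

Section weak_convergence.
Variables (R : realType) (X : normedModType R).

Definition weak_cvg (u : nat -> X) (x : X) : Prop :=
  forall f : dual X, f (u n) @[n --> \oo] --> f x.

Definition weak_star_cvg (u : nat -> dual X) (f : dual X) : Prop :=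
  forall x : X, u n x @[n --> \oo] --> f x.

End weak_convergence.

(* Surjectivity of the canonical embedding of X into its bidual. *)
Definition reflexive_space (R : realType) (X : normedModType R) : Prop :=
  forall phi : dual (dual X), exists x : X, forall f : dual X, phi f = f x.

Definition grothendieck_space (R : realType) (X : normedModType R) : Prop :=
  forall u : nat -> dual X,
    (exists f, weak_star_cvg u f) <-> (exists f, weak_cvg u f).

(* Main.v *)
From HB Require Import structures.
Require Import Defs.
From mathcomp Require Import all_boot all_order all_algebra.
From mathcomp Require Import all_classical all_reals topology normedtype.
From mathcomp Require Import finmap sequences ring lra.
From mathcomp Require wochoice.

(* If Y is overcomplete and g is a nonzero functional, then fewer than kappa
   points of Y lie in the kernel of g. Since the cofinality of kappa exceeds
   aleph_1, the kernels of aleph_1 nonzero functionals together do not cover Y.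
   So it is enough to find uncountably many nonzero functionals such that every
   x in X vanishes on all but countably many of them.

   As X is not reflexive, James' argument gives a bounded sequence f in the dual
   none of whose sequences of convex blocks is weakly convergent, hence, X being
   a Grothendieck space, none is weak* convergent. By Zorn's lemma take a
   maximal family of pairs (r, x), with r : nat -> [-1, 1], for which finitely
   supported probability measures on nat arbitrarily far out make the functions
   r almost orthogonal and give every integral of r * f(x) a value >= 1. A
   countable family is not maximal: along blocks adapted to it the means of f
   oscillate at some y, and averaging a high block with a low one, with r = 1 on
   the former and r = -1 on the latter, adds a pair. So the family is
   uncountable. If m is an ultrafilter limit of these measures, the functionals
   x |-> m(r * f(x)) are nonzero, and by Bessel's inequality in L^2(m) each x is
   a zero of all but countably many of them. *)

Set Implicit Arguments.
Unset Strict Implicit.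
Unset Printing Implicit Defensive.

Import Order.TTheory GRing.Theory Num.Theory.
Import numFieldNormedType.Exports.

Local Open Scope classical_set_scope.
Local Open Scope card_scope.

(** * Cardinals *)

Lemma card_le_total T U (A : set T) (B : set U) : A #<= B \/ B #<= A.
Proof.
pose S (b : bool) : Type := if b then T else U.
pose D (b : bool) : set (S b) := if b return set (S b) then A else B.
have [[] le] := @ex_card_min bool S D (inhabits true); first by left;
  exact: (le false).
by right; exact: (le true).
Qed.

Lemma card_leNgt T U (A : set T) (B : set U) : ~ (A #<= B) -> B #< A.
Proof.
move=> nAB; have [//|BA] := card_le_total A B; split=> //.
by apply/negP => /card_eqPle[_].
Qed.

Lemma card_ltNge T U (A : set T) (B : set U) : B #< A -> ~ (A #<= B).
Proof. by move=> [BA /negP nBA] AB; apply: nBA; apply/card_eqPle;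
  rewrite BA. Qed.

Lemma card_lt_trans T U V (A : set T) (B : set U) (C : set V) :
  A #< B -> B #<= C -> A #< C.
Proof.
move=> AB BC; apply: card_leNgt => CA.
exact: (card_ltNge AB (card_le_trans BC CA)).
Qed.

(** An injection given as a relation needs no inhabitant of the target and no functions between
    subtypes. It is also a set of pairs, so that partial injections can be ordered by inclusion. *)
Lemma card_le_relP T U (A : set T) (B : set U) : A #<= B <->
  exists R : T -> U -> Prop, (forall x, A x -> exists2 y, B y & R x y) /\
    (forall x x' y, A x -> A x' -> B y -> R x y -> R x' y -> x = x').
Proof.
split=> [/card_leP[f]|[R [Rtot Rinj]]].
  exists (fun x y => exists a : A, val a = x /\ val (f a) = y); split.
    by move=> x Ax; exists (val (f (SigSub (mem_set Ax))));
      [exact: set_valP|exists (SigSub (mem_set Ax))].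
  move=> x x' y _ _ _ [a [<- <-]] [b [<- /val_inj fab]].
  by congr val; apply: (@inj _ _ _ f); rewrite ?in_setT.
have /choice[f fP] : forall a : A, exists b : B, R (val a) (val b).
  move=> a; have [y By Ray] := Rtot _ (set_valP a).
  by exists (SigSub (mem_set By)).
apply/card_leP/injfunPex; exists f => // a b _ _ fab; apply: val_inj.
apply: (@Rinj _ _ (val (f a))) => //; try exact: set_valP.
by rewrite fab.
Qed.

Lemma card_le_fun T U (u0 : U) (A : set T) (B : set U) : A #<= B ->
  exists f : T -> U, (forall x, A x -> B (f x)) /\
    (forall x x', A x -> A x' -> f x = f x' -> x = x').
Proof.
move=> /card_le_relP[R [Rtot Rinj]].
have /choice[f fP] : forall x, exists y, A x -> B y /\ R x y.
  move=> x; have [/Rtot[y]|] := pselect (A x); first by exists y.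
  by exists u0.
exists f; split=> [x /fP[]//|x x' Ax Ax' fxx'].
have [Bx Rx] := fP _ Ax; have [_] := fP _ Ax'; rewrite -fxx' => Rx'.
exact: Rinj Rx Rx'.
Qed.

Lemma card_le_setX T T' U U' (A : set T) (A' : set T') (B : set U) (B' : set
  U') :
  A #<= B -> A' #<= B' -> A `*` A' #<= B `*` B'.
Proof.
move=> /card_le_relP[R [Rtot Rinj]] /card_le_relP[R' [Rtot' Rinj']].
apply/card_le_relP; exists (fun p q => R p.1 q.1 /\ R' p.2 q.2); split.
  move=> [x x'] [/= /Rtot[y By Rxy] /Rtot'[y' By' Rxy']].
  by exists (y, y').
move=> [x x'] [z z'] [y y'] [/= Ax Ax'] [/= Az Az'] [/= By By'] [/= xy xy'] [/=
  zy zy'].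
by rewrite (Rinj _ _ _ Ax Az By xy zy) (Rinj' _ _ _ Ax' Az' By' xy' zy').
Qed.

(** * Squares of infinite cardinals *)

(* A triple [(x, y, z)] of [N] says that the pair [(x, y)] is sent to [z]. *)
Section squaring.
Variables (T : Type) (S : set T).
Implicit Types N : set (T * T * T).

Definition dom N : set T := [set x | exists y z, N (x, y, z)].

(** Coding an injection of [D * D] into [D], for a varying [D] inside [S], as one set of triples
    makes extension plain inclusion, the order used in Zorn's lemma. *)
Definition squaring N :=
  [/\ forall x y, dom N x -> dom N y -> exists z, N (x, y, z),
      forall x y z, N (x, y, z) -> [/\ S x, dom N y & dom N z] &
      forall x y x' y' z, N (x, y, z) -> N (x', y', z) -> (x, y) = (x', y')].

Lemma squaring_le N : squaring N -> dom N `*` dom N #<= dom N.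
Proof.
move=> [Ntot Nsub Ninj]; apply/card_le_relP.
exists (fun p z => N (p.1, p.2, z)); split.
  by move=> [x y] [/= /Ntot xN /xN[z Nz]]; exists z => //;
    case: (Nsub _ _ _ Nz).
by move=> [x y] [x' y'] z _ _ _ /=; exact: Ninj.
Qed.

(** The seed for Zorn's lemma: a pairing of the naturals, transported to a countable subset of
    [S]. *)
Lemma ex_squaring : infinite_set S ->
  exists2 N, squaring N & infinite_set (dom N).
Proof.
move=> /infiniteP/card_le_relP[R [Rtot Rinj]].
have /choice[e eP] : forall n, exists x, S x /\ R n x.
  by move=> n; have [x ? ?] := Rtot n I; exists x.
have einj : injective e.
  by move=> m n emn; apply: (Rinj _ _ (e m)) => //; case: (eP m); case: (eP n);
    rewrite ?emn.
have /card_le_relP[P [Ptot Pinj]] : [set: nat * nat] #<= [set: nat].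
  by have /card_eqPle[] := card_nat2.
exists [set t | exists m n k, P (m, n) k /\ t = (e m, e n, e k)].
  have D x : dom [set t | exists m n k, P (m, n) k /\
    t = (e m, e n, e k)] x <-> range e x.
    split=> [[y [z [m [n [k [_ [-> _ _]]]]]]]|[m _ <-]]; first by exists m.
    have [k _ Pk] := Ptot (m, m) I; by exists (e m), (e k), m, m, k.
  split=> [x y /D[m _ <-] /D[n _ <-]|x y z|].
  - by have [k _ Pk] := Ptot (m, n) I; exists (e k), m, n, k.
  - move=> [m [n [k [_ [-> -> ->]]]]]; split; first by case: (eP m).
      by apply/D; exists n.
    by apply/D; exists k.
  move=> x y x' y' z [m [n [k [Pk [-> -> ->]]]]] [m' [n' [k' [Pk' [-> ->
    /einj kk']]]]].
  by rewrite -kk' in Pk'; have [-> ->] := Pinj _ _ _ I I I Pk Pk'.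
apply: (@sub_infinite_set _ (range e)).
  by move=> _ [m _ <-]; have [k _ Pk] := Ptot (m, m) I;
    exists (e m), (e k), m, m, k.
apply/infiniteP/card_le_relP; exists (fun n x => e n = x); split.
  by move=> n _; exists (e n).
by move=> m n x _ _ _ <- /esym/einj.
Qed.

(** With [k] a copy of [D = dom N] outside [D], the set [D'] of the points of [D] and of its copy is
    still no larger than [D]. The pairs of [D'] not inside [D] are coded in [D] by [h] and then sent
    by [k] into the copy, where they cannot meet the old values. *)
Lemma squaring_extend N : squaring N -> infinite_set (dom N) ->
  dom N #<= S `\` dom N -> exists2 N', squaring N' & N `<` N'.
Proof.
move=> sN Dinf; have [c0 [c1 [Dc0 Dc1 c01]]] :
    exists c0 c1, [/\ dom N c0, dom N c1 & c0 <> c1].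
  have /infiniteP/card_le_relP[g [gtot ginj]] := Dinf.
  have [c0 D0 g0] := gtot 0 I; have [c1 D1 g1] := gtot 1 I.
  exists c0, c1; split=> // c01.
  by have := ginj 0 1 c0 I I D0 g0; rewrite c01 => /(_ g1).
have /(card_le_fun c0)[f [fD finj]] := squaring_le sN.
have [Ntot Nsub Ninj] := sN.
move=> /(card_le_fun c0)[k [kE kinj]].
(* A point of [D `|` k @` D] is coded by a point of [D] and a tag in [D]. *)
pose D := dom N; pose D' := D `|` k @` D.
have kND x : D x -> ~ D (k x) by move=> /kE[].
have /choice[code codeP] : forall x, exists p, D' x ->
    [/\ D p.1, D p.2, D x -> p = (x, c0) & ~ D x -> k p.1 = x /\ p.2 = c1].
  move=> x; have [Dx|nDx] := pselect (D x); first by exists (x, c0).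
  have [[//|[d Dd kd]]|nD'x] := pselect (D' x); first by exists (d, c1).
  by exists (c0, c0).
have code_inj x y : D' x -> D' y -> code x = code y -> x = y.
  move=> /codeP[Dx1 Dx2 x1 x2] /codeP[Dy1 Dy2 y1 y2] xy.
  have [Dx|nDx] := pselect (D x); have [Dy|nDy] := pselect (D y).
  - by move: xy; rewrite x1// y1// => -[].
  - by case: c01; have [_ <-] := y2 nDy; rewrite -xy x1.
  - by case: c01; have [_ <-] := x2 nDx; rewrite xy y1.
  - by have [<- _] := x2 nDx; have [<- _] := y2 nDy; rewrite xy.
(* [f] pairs the two points, pairs the two tags, and then pairs the results. *)
pose h x y := f (f ((code x).1, (code y).1), f ((code x).2, (code y).2)).
have f2D a b : D a -> D b -> D (f (a, b)).
  by move=> Da Db; exact: fD.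
have f2inj a b a' b' : D a -> D b -> D a' -> D b' -> f (a, b) = f (a', b') ->
    a = a' /\ b = b'.
  by move=> Da Db Da' Db' /(finj (a, b) (a', b') (conj Da Db) (conj Da' Db'))[].
have hD x y : D' x -> D' y -> D (h x y).
  by move=> /codeP[? ? _ _] /codeP[? ? _ _]; apply: (f2D); exact: f2D.
have h_inj x y x' y' : D' x -> D' y -> D' x' -> D' y' -> h x y = h x' y' ->
    (x, y) = (x', y').
  move=> D'x D'y D'x' D'y'.
  have [? ? _ _] := codeP _ D'x; have [? ? _ _] := codeP _ D'y.
  have [? ? _ _] := codeP _ D'x'; have [? ? _ _] := codeP _ D'y'.
  move=> e; have [e' e''] : f ((code x).1, (code y).1) = f ((code x').1,
    (code y').1) /\
      f ((code x).2, (code y).2) = f ((code x').2, (code y').2).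
    by apply: f2inj e; exact: f2D.
  have [e1 e3] : (code x).1 = (code x').1 /\
    (code y).1 = (code y').1 by exact: f2inj e'.
  have [e2 e4] : (code x).2 = (code x').2 /\
    (code y).2 = (code y').2 by exact: f2inj e''.
  by congr (_, _); apply: code_inj => //;
    rewrite [LHS]surjective_pairing ?e1 ?e2 ?e3 ?e4 -surjective_pairing.
pose new := [set t | exists x y, [/\ D' x, D' y, ~ (D x /\
  D y) & t = (x, y, k (h x y))]].
pose N' := N `|` new.
have DN' x : dom N' x <-> D' x.
  split=> [[y [z [Nxyz|[x' [y' [D'x _ _ [-> _ _]]]]]]]|].
  - by left; exists y, z.
  - by [].
  move=> [[y [z xyz]]|[d Dd <-]]; first by exists y, z; left.
  exists (k d), (k (h (k d) (k d))); right; exists (k d), (k d); split=> //.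
  - by right; exists d.
  - by right; exists d.
  - by move=> [/(kND _ Dd)].
have D'S x : D' x -> S x.
  by move=> [[y [z /Nsub[]]]|[d /kE[? _] <-]].
exists N'; last first.
  split=> [|NN']; first by move=> t; left.
  have : N (k c0, k c0, k (h (k c0) (k c0))).
    apply: NN'; right; exists (k c0), (k c0); split=> //.
    - by right; exists c0.
    - by right; exists c0.
    - by move=> [/(kND _ Dc0)].
  by move=> Nk; apply: (kND _ Dc0); exists (k c0), (k (h (k c0) (k c0))).
split.
- move=> x y /DN' D'x /DN' D'y; have [[Dx Dy]|nD] := pselect (D x /\ D y).
    by have [z] := Ntot _ _ Dx Dy; exists z; left.
  by exists (k (h x y)); right; exists x, y.
- move=> x y z [/Nsub[Sx Dy Dz]|[x' [y' [D'x D'y _ [-> -> ->]]]]].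
    by split=> //; apply/DN'; left.
  split; [exact: D'S|exact/DN'|apply/DN'; right].
  by exists (h x' y') => //; exact: hD.
- move=> x y x' y' z [xyz|[a [b [D'a D'b _ [-> -> ->]]]]].
    move=> [|[a [b [D'a D'b _ [_ _ zE]]]]]; first exact: Ninj xyz.
    have [_ _] := Nsub _ _ _ xyz; rewrite zE => Dk.
    by exfalso; apply: (kND (h a b)) => //; exact: hD.
  move=> [/Nsub[_ _ Dk]|[a' [b' [D'a' D'b' _ [-> ->]]]]].
    by exfalso; apply: (kND (h a b)) => //; exact: hD.
  by move=> /kinj e; apply: h_inj => //; apply: e; exact: hD.
Qed.

(** For a maximal squaring with domain [D], the rest of [S] cannot contain a copy of [D], so it is
    no larger than [D]. Then [S] embeds into two tagged copies of [D], hence into [D * D] and into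
    [D]. *)
Lemma infinite_card_leXX : infinite_set S -> S `*` S #<= S.
Proof.
move=> /ex_squaring[N0 sN0 N0inf].
(* Joining [N0] keeps the domain infinite, and settles the empty chain. *)
pose P (M : set (T * T * T)) := squaring (N0 `|` M).
have [G GP Gtot|M [PM Mmax]] := @Zorn_bigcup _ P.
  (* Two elements of the union already lie in some squaring below it. *)
  have pair t u : (N0 `|` \bigcup_(X in G) X) t ->
    (N0 `|` \bigcup_(X in G) X) u ->
      exists N, [/\ squaring N, N `<=` N0 `|` \bigcup_(X in G) X, N t & N u].
    have sub X : G X -> N0 `|` X `<=` N0 `|` \bigcup_(X in G) X.
      by move=> GX v [?|Xv]; [left|right; exists X].
    have one X : G X -> (N0 `|` X) t -> (N0 `|` X) u ->
      exists N, [/\ squaring N, N `<=` N0 `|` \bigcup_(X in G) X, N t & N u].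
      by move=> GX Xt Xu; exists (N0 `|` X); split=> //; [exact: GP|exact: sub].
    move=> [N0t|[X GX Xt]] [N0u|[Y GY Yu]].
    - by exists N0; split=> // v; left.
    - by apply: (one Y) => //; [left|right].
    - by apply: (one X) => //; [right|left].
    have [XY|YX] := Gtot _ _ GX GY.
      by apply: (one Y) => //; right => //; exact: XY.
    by apply: (one X) => //; right => //; exact: YX.
  split.
  - move=> x y [y' [z' xyz]] [x' [z'' yxz]].
    have [N [[Ntot _ _] NG Nx Ny]] := pair _ _ xyz yxz.
    have [||z xyz'] := Ntot x y; first by exists y', z'.
      by exists x', z''.
    by exists z; exact: NG.
  - move=> x y z xyz; have [N [[_ Nsub _] NG Nx _]] := pair _ _ xyz xyz.
    have [Sx [y' [z' Ny]] [x' [z'' Nz]]] := Nsub _ _ _ Nx.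
    by split=> //; [exists y', z'|exists x', z'']; exact: NG.
  - move=> x y x' y' z xyz xyz'.
    by have [N [[_ _ Ninj] _ Nx Nx']] := pair _ _ xyz xyz'; exact: Ninj Nx Nx'.
have Dinf : infinite_set (dom (N0 `|` M)).
  apply: sub_infinite_set N0inf => x [y [z xyz]]; exists y, z; by left.
set N := N0 `|` M in PM Dinf *.
have DS : dom N `<=` S by move=> x [y [z xyz]]; case: PM => _ /(_ _ _ _ xyz)[].
have DD := squaring_le PM.
have SD : S #<= dom N; last first.
  by apply: card_le_trans (card_le_trans DD _);
    [exact: card_le_setX|exact: subset_card_le].
have SDD : S `\` dom N #<= dom N.
  have [//|/(squaring_extend PM Dinf)[N' sN' [NN' N'N]]] :=
    card_le_total (S `\` dom N) (dom N).
  exfalso; apply: (Mmax N'); last first.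
    by rewrite /P (_ : N0 `|` N' = N')//; apply/setUidPr => t N0t; apply: NN';
      left.
  by split=> [t Mt|N'M]; [apply: NN'; right|apply: N'N => t /N'M; right].
have /infiniteP/card_le_relP[g [gtot ginj]] := Dinf.
have [c0 D0 g0] := gtot 0 I; have [c1 D1 g1] := gtot 1 I.
have c01 : c0 <> c1.
  by move=> c01; have := ginj 0 1 c0 I I D0 g0; rewrite c01 => /(_ g1).
have /(card_le_fun c0)[k [kE kinj]] := SDD.
apply: card_le_trans DD; apply/card_le_relP.
exists (fun x p => dom N x /\ p = (x, c0) \/ ~ dom N x /\ p = (k x, c1)); split.
  move=> x Sx; have [Dx|nDx] := pselect (dom N x).
    by exists (x, c0) => //; left.
  by exists (k x, c1); [split=> //=; exact: kE|right].
move=> x y _ Sx Sy _ [[Dx ->]|[Dx ->]] [[Dy /esym[]]|[Dy /esym[]]] //.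
- by move=> _ /esym/c01.
- by move=> /kinj->.
Qed.
End squaring.

(** * Small unions below the cofinality *)

Section cofinality.
Variable kappa : cardinal.

Definition initial_segment (a : kappa) : set kappa :=
  [set b | card_order b a /\ b <> a].

Lemma card_order_refl (a : kappa) : card_order a a.
Proof.
have [|b [[/asboolP ba amin] _]] :=
  @card_order_wo kappa (fun b => `[< b = a >]); first by exists a;
    apply/asboolP.
by rewrite -{1}ba; apply: amin; apply/asboolP.
Qed.

Lemma card_order_anti (a b : kappa) : card_order a b -> card_order b a -> a = b.
Proof.
move=> ab ba; have [|c [_ cmin]] :=
  @card_order_wo kappa (fun c => `[< c = a \/ c = b >]).
  by exists a; apply/asboolP; left.
have ca : c = a.
  apply: cmin; split; first by apply/asboolP; left.
  by move=> _ /asboolP[->|->]//; exact: card_order_refl.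
have cb : c = b.
  apply: cmin; split; first by apply/asboolP; right.
  by move=> _ /asboolP[->|->]//; exact: card_order_refl.
by rewrite -ca -cb.
Qed.

Lemma card_order_total (a b : kappa) : card_order a b \/ card_order b a.
Proof.
have [|c [[/asboolP[->|->] cmin] _]] :=
  @card_order_wo kappa (fun c => `[< c = a \/ c = b >]).
- by exists a; apply/asboolP; left.
- by left; apply: cmin; apply/asboolP; right.
- by right; apply: cmin; apply/asboolP; left.
Qed.

Lemma card_order_trans (a b c : kappa) :
  card_order a b -> card_order b c -> card_order a c.
Proof.
move=> ab bc; have [|d [[/asboolP dE dmin] _]] :=
  @card_order_wo kappa (fun d => `[< d = a \/ d = b \/ d = c >]).
  by exists a; apply/asboolP; left.
have da : card_order d a by apply: dmin; apply/asboolP; left.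
have db : card_order d b by apply: dmin; apply/asboolP; right; left.
have dc : card_order d c by apply: dmin; apply/asboolP; right; right.
case: dE => [<-//|[]dE]; subst d.
  by rewrite (card_order_anti ab da).
by rewrite (card_order_anti bc db) in ab.
Qed.

Lemma card_lt_initial_segment U (B : set U) : B #< [set: kappa] ->
  exists a, B #<= initial_segment a.
Proof.
move=> /card_ltNge kB; apply: contrapT => /forallNP noa.
(* A maximal injection of an initial part of [kappa] into [B] is total. *)
pose P (M : set (kappa * U)) := [/\ forall a b u, M (a, u) -> card_order b a ->
    exists v, M (b, v), forall a u, M (a, u) -> B u,
    forall a b u, M (a, u) -> M (b, u) -> a = b &
    forall a u v, M (a, u) -> M (a, v) -> u = v].
have [G GP Gtot|M [[Mdown MB Minj Mfun] Mmax]] := @Zorn_bigcup _ P.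
  have pair t u : (\bigcup_(X in G) X) t -> (\bigcup_(X in G) X) u ->
      exists X, [/\ G X, X t & X u].
    move=> [X GX Xt] [Y GY Yu]; have [XY|YX] := Gtot _ _ GX GY.
      by exists Y; split=> //; exact: XY.
    by exists X; split=> //; exact: YX.
  split.
  - move=> a b u [X GX Xau] ba; have [Xdown _ _ _] := GP _ GX.
    by have [v Xbv] := Xdown _ _ _ Xau ba; exists v, X.
  - by move=> a u [X GX Xau]; have [_ XB _ _] := GP _ GX; exact: XB Xau.
  - move=> a b u au bu; have [X [GX Xa Xb]] := pair _ _ au bu.
    by have [_ _ Xinj _] := GP _ GX; exact: Xinj Xa Xb.
  - move=> a u v au bu; have [X [GX Xa Xb]] := pair _ _ au bu.
    by have [_ _ _ Xfun] := GP _ GX; exact: Xfun Xa Xb.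
have [Mtot|/existsNP[a0 na0]] := pselect (forall a, exists u, M (a, u)).
  apply: kB; apply/card_le_relP; exists (fun a u => M (a, u)); split.
    by move=> a _; have [u Mau] := Mtot a; exists u => //; exact: MB Mau.
  by move=> a b u _ _ _; exact: Minj.
have [|a [[/asboolP na amin] _]] :=
  @card_order_wo kappa (fun a => `[< ~ exists u, M (a, u) >]).
  by exists a0; apply/asboolP.
have domM b : (exists u, M (b, u)) <-> initial_segment a b.
  split=> [[u Mbu]|[ba nba]].
    have nab : ~ card_order a b.
      by move=> ab; apply: na; exact: Mdown Mbu ab.
    split; first by have [] := card_order_total a b.
    by move=> ba; apply: nab; rewrite ba; exact: card_order_refl.
  apply: contrapT => nb; apply: nba; apply: card_order_anti => //.
  by apply: amin; apply/asboolP.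
(* [M] does not exhaust [B]: its inverse would embed [B] into the initial segment of [a]. A spare
   [b] then extends [M] at [a]. *)
have [b Bb nMb] : exists2 b, B b & forall c, ~ M (c, b).
  apply: contrapT => nob; apply: (noa a); apply/card_le_relP.
  exists (fun u c => M (c, u)); split; last by move=> u v c _ _ _; exact: Mfun.
  move=> u Bu; have [c Mcu] : exists c, M (c, u).
    by apply: contrapT => /forallNP nMu; apply: nob; exists u.
  by exists c => //; apply/domM; exists u.
apply: (Mmax (M `|` [set (a, b)])).
  split=> [|sub]; first by move=> t; left.
  by apply: na; exists b; apply: sub; right.
split.
- move=> c d u [Mcu dc|[-> _] da]; first by have [v] := Mdown _ _ _ Mcu dc;
  exists v; left.
  have [->|dna] := pselect (d = a); first by exists b; right.
  by have /domM[v] : initial_segment a d by []; exists v; left.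
- by move=> c u [/MB//|[_ ->]].
- move=> c d u [Mcu|[ca ub]] [Mdu|[da ub']].
  + exact: Minj Mcu Mdu.
  + by rewrite ub' in Mcu; case: (nMb _ Mcu).
  + by rewrite ub in Mdu; case: (nMb _ Mdu).
  + by rewrite ca da.
- move=> c u v [Mcu|[ca ub]] [Mcv|[ca' vb]].
  + exact: Mfun Mcu Mcv.
  + by rewrite ca' in Mcu; case: na; exists u.
  + by rewrite ca in Mcv; case: na; exists v.
  + by rewrite ub vb.
Qed.

(** Each [A j] embeds into the initial segment of some [s j]. Fewer than [cf kappa] points are not
    cofinal, so a single [a] bounds all of them, and the union embeds into the product of [i] and
    one initial segment. The larger factor is infinite and smaller than [kappa], and absorbs its
    square. *)
Lemma card_lt_cf_bigcup I U (i : set I) (A : I -> set U) :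
  infinite_set i -> i #< cf kappa -> (forall j, i j -> A j #< [set: kappa]) ->
  \bigcup_(j in i) A j #< [set: kappa].
Proof.
move=> iinf icf Akappa; have [cfcof cfmin] := cfP kappa.
have ik : i #< [set: kappa] by apply: card_lt_trans icf (card_leT _).
have [a0 _] : exists a : kappa, True.
  apply: contrapT => nk; apply: (card_ltNge ik); apply/card_le_relP.
  by exists (fun _ _ => True); split=> [a _|a]; case: nk; exists a.
have /choice[s sP] : forall j, exists a, i j -> A j #<= initial_segment a.
  move=> j; have [ij|] := pselect (i j); last by exists a0.
  by have [a] := card_lt_initial_segment (Akappa _ ij); exists a.
have [a sa] : exists a, forall j, i j ->
  initial_segment (s j) `<=` initial_segment a.
  apply: contrapT => noa; apply: (card_ltNge icf).
  apply: card_le_trans (card_image_le s i); apply: cfmin => a.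
  apply: contrapT => nsa; apply: noa; exists a => j ij b [bs bns].
  have nas : ~ card_order a (s j) by move=> asj; apply: nsa;
    exists (s j) => //; exists j.
  have sja : card_order (s j) a by have [] := card_order_total a (s j).
  split; first exact: card_order_trans sja.
  by move=> ba; apply: nas; rewrite -ba.
have [c [kinf ck le1 le2]] : exists c : set kappa, [/\ infinite_set c,
  c #< [set: kappa], i #<= c &
    initial_segment a #<= c].
  have ak := card_order_initial a.
  have [ia|ai] := card_le_total i (initial_segment a).
    exists (initial_segment a); split => //.
    by move=> /(card_le_finite ia).
  (* A copy of [i] inside [kappa]. *)
  have /card_subP[c ic _] : i #<= [set: kappa] by case: ik.
  have [ic1 ic2] : i #<= c /\ c #<= i by apply/card_eqPle; rewrite card_eq_sym.
  exists c; split=> //.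
  - by move=> /(card_le_finite ic1).
  - by apply: card_leNgt => kc; apply: (card_ltNge ik);
    exact: card_le_trans kc ic2.
  - exact: card_le_trans ai ic1.
apply: card_leNgt => kA; apply: (card_ltNge ck); apply: (card_le_trans kA).
apply: card_le_trans (infinite_card_leXX kinf).
apply: (card_le_trans _ (card_le_setX le1 le2)).
have /choice[R RP] : forall j, exists R : U -> kappa -> Prop, i j -> 
  (forall x, A j x -> exists2 y, initial_segment a y & R x y) /\
    (forall x x' y, A j x -> A j x' -> initial_segment a y -> R x y ->
      R x' y -> x = x').
  move=> j; have [ij|] := pselect (i j); last by exists (fun _ _ => True).
  have /card_le_relP[R RP] :=
    card_le_trans (sP _ ij) (subset_card_le (sa _ ij)).
  by exists R.
apply/card_le_relP; exists (fun x p => i p.1 /\ A p.1 x /\ R p.1 x p.2); split.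
  move=> x [j ij Ajx]; have [/(_ _ Ajx)[y ay Rxy] _] := RP _ ij.
  by exists (j, y).
move=> x x' [j y] _ _ [/= _ ay] [ij [Ax Rx]] [_ [Ax' Rx']].
by have [_ /(_ _ _ _ Ax Ax' ay Rx Rx')] := RP _ ij.
Qed.

End cofinality.

(** * Functionals on normed spaces *)

Local Open Scope ring_scope.

Section functionals.
Variables (R : realType) (V : normedModType R).

Lemma bounded_linear_dual (g : V -> R) (C : R) :
  (forall a x y, g (a *: x + y) = a * g x + g y) ->
  (forall x, `|g x| <= C * `|x|) -> exists f : dual V, forall x, f x = g x.
Proof.
move=> lin bnd.
pose gl : {linear V -> R^o} :=
  HB.pack_for {linear V -> R^o} (g : V ->
    R^o) (GRing.isLinear.Build R V R^o *:%R g lin).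
have gc : continuous gl.
  apply/linear_bounded_continuous/bounded_funP => r.
  exists (`|C| * `|r|) => x xr; apply: le_trans (bnd x) _.
  apply: le_trans (ler_norm _) _; rewrite normrM normr_id ler_wpM2l//.
  exact: le_trans xr (ler_norm _).
have glP : (gl : V -> R^o) \in @continuous_linear R V.
  by rewrite inE; apply/andP; split; apply/asboolP => //; exact: linearP.
by exists (Dual glP).
Qed.

(** This serves three times: for weak* limits of sequences, for a cluster point in the bidual, and
    for limits along an ultrafilter on trees. *)
Lemma lim_dual (I : Type) (F : set_system I) (h : I -> V -> R) (C : R) :
  ProperFilter F ->
  (forall i a x y, h i (a *: x + y) = a * h i x + h i y) ->
  (forall i x, `|h i x| <= C * `|x|) ->
  (forall x, exists l : R, h i x @[i --> F] --> l) ->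
  exists f : dual V, forall x, h i x @[i --> F] --> (f x : R).
Proof.
move=> FF lin bnd /choice[g hg].
have [|x|f fg] := @bounded_linear_dual g C.
- move=> a x y; apply: (cvg_unique _ (hg _)) => //=.
  under eq_fun do rewrite lin.
  by apply: cvgD; [apply: cvgMr; exact: hg|exact: hg].
- apply: (cvgr_to_le (cvg_norm (hg x))).
  by apply: nearW => i; exact: bnd.
by exists f => x; rewrite fg; exact: hg.
Qed.

Lemma dual_bound_le (f : dual V) (C : R) :
  (forall x, `|f x| <= C * `|x|) -> 0 <= C -> `|f| <= C.
Proof.
move=> fC C0; apply: dual_norm_le => x x1; apply: le_trans (fC x) _.
by rewrite ler_piMr.
Qed.

Lemma dual_ext (f g : dual V) : (forall x, f x = g x) -> f = g.
Proof. by move=> fg; apply/val_inj/funext. Qed.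

Lemma ler_norm_dual (f : dual V) x : `|f x| <= `|f| * `|x|.
Proof. exact: dual_norm_ub. Qed.

Lemma dualE_sum n (a : 'I_n -> R) (l : 'I_n -> dual V) x :
  (\sum_i a i *: l i) x = \sum_i a i * l i x.
Proof.
elim/big_ind2 : _ => //= f r g s.
by move=> <- <-.
Qed.

(* The distance from [c] to the convex set [{(l i x)_i | `|x| <= M}] is zero: at
   a near-minimizer [x] of the squared distance, the functional with weights
   [c i - l i x] nearly separates. *)
Lemma helly n (l : 'I_n -> dual V) (c : 'I_n -> R) (M : R) : 0 < M ->
  (forall a : 'I_n -> R, \sum_i a i * c i <= M * `|\sum_i a i *: l i|) ->
  forall e : R, 0 < e -> exists2 x, `|x| <= M & forall i, `|l i x - c i| < e.
Proof.
move=> M0 Hc e e0.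
pose Q x := \sum_i (l i x - c i) ^+ 2.
pose K := \sum_i (`|l i| * (M + M)) ^+ 2.
have K0 : 0 <= K by apply: sumr_ge0 => i _; exact: sqr_ge0.
have Q0 x : 0 <= Q x by apply: sumr_ge0 => i _; exact: sqr_ge0.
(* The step length of a descent: at most 1, so that [y] below stays in the ball, and small enough
   that the final error [t * (1 + K) / 2] is at most [e ^+ 2 / 2]. *)
pose t := Num.min 1 (e ^+ 2 / (1 + K)).
have t0 : 0 < t by rewrite lt_min ltr01 divr_gt0 ?exprn_gt0// ltr_wpDr.
have t1 : t <= 1 by rewrite ge_min lexx.
have tK : t * (1 + K) <= e ^+ 2.
  by rewrite -ler_pdivlMr ?ltr_wpDr// ge_min lexx orbT.
have Qinf : has_inf [set Q x | x in [set x | `|x| <= M]].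
  split; first by exists (Q 0); exists 0 => //=; rewrite normr0 ltW.
  by exists 0 => _ [x _ <-].
have [_ [x /= xM <-] Qx] := inf_adherent (exprn_gt0 2 t0) Qinf.
suff Qe : Q x < e ^+ 2.
  exists x => // i; rewrite -(ltr_pXn2r (n := 2))// ?nnegrE ?(ltW e0)//.
  rewrite real_normK ?num_real//; apply: le_lt_trans Qe.
  by rewrite /Q (bigD1 i)//= lerDl sumr_ge0// => j _; exact: sqr_ge0.
pose a i := c i - l i x; pose L := \sum_i a i *: l i.
(* Moving from [x] towards [z] by [t] lowers [Q] by less than [t ^+ 2]. Expanding the square, where
   [K] bounds the quadratic term, and dividing by [2 * t] bounds [L z - L x]. *)
have Lz z : `|z| <= M -> L z <= L x + t * (1 + K) / 2.
  move=> zM; set y := x + t *: (z - x).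
  have yM : `|y| <= M.
    have -> : y = (1 - t) *: x + t *: z.
      by rewrite /y scalerBr scalerBl scale1r addrAC addrA.
    apply: le_trans (ler_normD _ _) _; rewrite !normrZ.
    rewrite (ger0_norm (ltW t0)) ger0_norm ?subr_ge0//.
    have : (1 - t) * `|x| + t * `|z| <= (1 - t) * M + t * M.
      by rewrite lerD// ler_wpM2l ?subr_ge0// ltW.
    by rewrite -mulrDl subrK mul1r.
  have Qy : inf [set Q x | x in [set x | `|x| <= M]] <= Q y.
    by apply: ge_inf; [exact: Qinf.2|exists y].
  have : Q y <= Q x - 2 * t * (L z - L x) + t ^+ 2 * K.
    rewrite /L !dualE_sum -sumrB mulr_sumr /Q /K mulr_sumr -sumrB -big_split/=.
    apply: ler_sum => i _; rewrite /y linearD linearZ linearB/=.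
    have : (l i z - l i x) ^+ 2 <= (`|l i| * (M + M)) ^+ 2.
      rewrite -linearB -real_normK ?num_real// lerXn2r ?nnegrE//.
        by rewrite mulr_ge0// addr_ge0// ltW.
      apply: le_trans (ler_norm_dual _ _) _; rewrite ler_wpM2l ?dual_norm_ge0//.
      by apply: le_trans (ler_normB _ _) _; exact: lerD.
    move=> /(ler_wpM2l (sqr_ge0 t)).
    rewrite /a /GRing.scale/=; nra.
  move: Qx Qy; nra.
have LM : M * `|L| <= L x + t * (1 + K) / 2.
  rewrite mulrC -ler_pdivlMr//; apply: dual_norm_le => w w1.
  rewrite ler_pdivlMr// mulrC -{1}(gtr0_norm M0) -normrM.
  rewrite -[M * _]/(M *: L w) -linearZ/= ler_norml.
  have MwM : `|M *: w| <= M by rewrite normrZ gtr0_norm// ler_piMr// ltW.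
  rewrite Lz// andbT lerNl -linearN/= Lz//.
  by rewrite normrN.
(* [Q x] equals the sum of the [a i * c i] minus [L x], and by hypothesis this sum is at most [M]
   times the norm of [L]. *)
have : Q x <= t * (1 + K) / 2.
  rewrite -(lerD2l (L x)); apply: le_trans LM; apply: le_trans (Hc a).
  rewrite /L dualE_sum /Q -big_split/=; apply: ler_sum => i _.
  rewrite /a; lra.
have : 0 < e ^+ 2 by exact: exprn_gt0.
by move: tK; lra.
Qed.

(** * Sublinear functionals and the Hahn-Banach theorem *)

Definition sublinear (q : V -> R) := (forall x y, q (x + y) <= q x + q y) /\
  (forall t x, 0 <= t -> q (t *: x) = t * q x).

Lemma sublinear0 q : sublinear q -> q 0 = 0.
Proof. by move=> [_ /(_ 0 0 (lexx _))]; rewrite scale0r mul0r. Qed.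

Lemma sublinear_ge q x : sublinear q -> - q (- x) <= q x.
Proof.
move=> [qD qZ]; have := qD x (- x); rewrite subrr.
by have := qZ 0 0 (lexx _); rewrite scale0r mul0r => ->; lra.
Qed.

(* Applied to a minimal [q], this shows that [q] is additive. *)
Lemma sublinear_shift q y : sublinear q -> exists q', [/\ sublinear q',
  forall x, q' x <= q x & forall x, q' x <= q (x + y) - q y].
Proof.
move=> [qD qZ].
(* The infimum [q'] of [S] is the shifted functional: [t = 0] gives the bound by [q], and [t = 1]
   the bound by [q (x + y) - q y]. *)
pose S x := [set q (x + t *: y) - t * q y | t in [set t | 0 <= t]].
have Sinf x : has_inf (S x).
  split; first by exists (q (x + 0 *: y) - 0 * q y); exists 0 => /=.
  exists (- q (- x)) => _ [t /= t0 <-].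
  by have := qD (x + t *: y) (- x); rewrite addrAC subrr add0r qZ//; lra.
pose q' x := inf (S x).
have q'le x t : 0 <= t -> q' x <= q (x + t *: y) - t * q y.
  by move=> t0; apply: ge_inf; [exact: (Sinf x).2|exists t].
have q'ge x b : (forall t, 0 <= t -> b <= q (x + t *: y) - t * q y) ->
  b <= q' x.
  by move=> bS; apply: lb_le_inf; [exact: (Sinf x).1|move=> _ [t /= t0 <-];
    exact: bS].
have q'Z t x : 0 < t -> q' (t *: x) <= t * q' x.
  move=> t0; rewrite mulrC -ler_pdivrMr//; apply: (q'ge) => u u0.
  rewrite ler_pdivrMr//; apply: le_trans (q'le _ (t * u) _) _.
    by rewrite mulr_ge0// ltW.
  by rewrite -scalerA -scalerDr qZ ?(ltW t0)//; lra.
exists q'; split.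
- split=> [x x'|t x].
    rewrite -lerBlDr; apply: (q'ge) => t t0; rewrite lerBlDl -lerBlDr.
    apply: (q'ge) => u u0; rewrite lerBlDl.
    apply: le_trans (q'le _ (t + u) _) _; first exact: addr_ge0.
    have := qD (x + t *: y) (x' + u *: y).
    by rewrite addrACA -scalerDl; lra.
  rewrite le_eqVlt => /predU1P[<-|t0].
    rewrite scale0r mul0r; apply/eqP; rewrite eq_le; apply/andP; split.
      have := q'le 0 0 (lexx _); rewrite scale0r mul0r addr0.
      by have := qZ 0 0 (lexx _); rewrite scale0r mul0r => ->; lra.
    by apply: (q'ge) => u u0; rewrite add0r qZ// subrr.
  apply/eqP; rewrite eq_le q'Z//= mulrC -ler_pdivlMr// mulrC.
  by rewrite -{1}(scale1r x) -(mulVf (lt0r_neq0 t0)) -scalerA q'Z// invr_gt0.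
- by move=> x; have := q'le x 0 (lexx _); rewrite scale0r mul0r addr0 subr0.
- by move=> x; have := q'le x 1 ler01; rewrite scale1r mul1r.
Qed.

(** Zorn's lemma for the reversed pointwise order. The infimum of a chain is finite because its
    members stay above [- p (- x)], and subadditive because any two members are comparable. *)
Lemma sublinear_minimal p : sublinear p -> exists2 q, sublinear q &
  (forall x, q x <= p x) /\
  forall r, sublinear r -> (forall x, r x <= q x) -> forall x, r x = q x.
Proof.
move=> slp.
pose T := {q : V -> R | sublinear q /\ forall x, q x <= p x}.
pose Z (q r : T) := `[< forall x, sval r x <= sval q x >].
have [|q r s /asboolP qr /asboolP rs|q r /asboolP qr /asboolP rq|A Atot|q qmin]
  := @Zorn T Z.
- by move=> q; apply/asboolP.
- by apply/asboolP => x; exact: le_trans (rs x) (qr x).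
- case: q r qr rq => [q Tq] [r Tr] /= qr rq.
  have qrE : q = r by apply/funext => x; apply/eqP; rewrite eq_le rq qr.
  by subst r; congr exist; exact: Prop_irrelevance.
- have [[q0 Aq0]|/forallNP A0] := pselect (exists q, A q); last first.
    have pT : sublinear p /\ forall x, p x <= p x by [].
    by exists (exist _ p pT) => q /A0.
  pose S x := [set sval q x | q in A].
  have Sinf x : has_inf (S x).
    split; first by exists (sval q0 x); exists q0.
    exists (- p (- x)) => _ [[q [slq qp]] Aq <-] /=.
    by apply: le_trans (sublinear_ge x slq); rewrite lerN2.
  pose q x := inf (S x).
  have qle x r : A r -> q x <= sval r x.
    by move=> Ar; apply: ge_inf; [exact: (Sinf x).2|exists r].
  have qge x b : (forall r, A r -> b <= sval r x) -> b <= q x.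
    by move=> bS; apply: lb_le_inf; [exact: (Sinf x).1|move=> _ [r Ar <-];
      exact: bS].
  have qT : sublinear q /\ forall x, q x <= p x.
    split=> [|x]; last by apply: le_trans (qle x _ Aq0) _; case: (svalP q0).
    split=> [x y|t x].
      rewrite -lerBlDr; apply: (qge) => r Ar; rewrite lerBlDl -lerBlDr.
      apply: (qge) => s As; rewrite lerBlDl.
      have [[rD _] _] := svalP r; have [[sD _] _] := svalP s.
      have [/asboolP rs|/asboolP sr] := Atot _ _ Ar As.
        apply: le_trans (qle _ _ As) (le_trans (sD x y) _).
        by rewrite lerD2r rs.
      apply: le_trans (qle _ _ Ar) (le_trans (rD x y) _).
      by rewrite lerD2l sr.
    rewrite le_eqVlt => /predU1P[<-|t0].
      rewrite scale0r mul0r.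
      have r0 (r : T) : sval r 0 = 0 by have [/sublinear0] := svalP r.
      apply/eqP; rewrite eq_le; apply/andP; split.
        by have := qle 0 _ Aq0; rewrite r0.
      by apply: (qge) => r _; rewrite r0.
    have qZ u z : 0 < u -> q (u *: z) <= u * q z.
      move=> u0; rewrite mulrC -ler_pdivrMr//; apply: (qge) => r Ar.
      rewrite ler_pdivrMr//; apply: le_trans (qle _ _ Ar) _.
      by have [[_ rZ] _] := svalP r; rewrite mulrC (rZ _ _ (ltW u0)).
    apply/eqP; rewrite eq_le qZ//= mulrC -ler_pdivlMr// mulrC.
    by rewrite -{1}(scale1r x) -(mulVf (lt0r_neq0 t0)) -scalerA qZ// invr_gt0.
  by exists (exist _ q qT) => r Ar; apply/asboolP => x; exact: qle.
have [slq qp] := svalP q; exists (sval q) => //; split=> // r slr rq x.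
have rT : sublinear r /\ forall x, r x <= p x.
  by split=> // y; exact: le_trans (rq y) (qp y).
have := qmin (exist _ r rT); move=> <- //.
exact/asboolP.
Qed.

(** The norm shifted by [x0] takes a value at most [- |x0|] at [- x0]. A minimal sublinear
    functional below it is linear, so its value at [x0] is at least [|x0|], while the norm still
    dominates it. *)
Lemma norming_dual (x0 : V) : exists2 f : dual V, `|f| <= 1 & f x0 = `|x0|.
Proof.
have slp : sublinear (fun x : V => `|x|).
  by split=> [x y|t x t0]; [exact: ler_normD|rewrite normrZ ger0_norm].
have [p' [slp' p'p p'x0]] := sublinear_shift x0 slp.
have [q slq [qp' qmin]] := sublinear_minimal slp'.
have [qD qZ] := slq.
have qadd x y : q (x + y) = q x + q y.
  apply/eqP; rewrite eq_le qD/=; have [r [slr rq rqy]] := sublinear_shift y slq.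
  by have := rqy x; rewrite (qmin _ slr rq) lerBrDr.
have q0 : q 0 = 0 by have := qZ 0 0 (lexx _); rewrite scale0r mul0r.
have qN x : q (- x) = - q x.
  by apply/eqP; rewrite -addr_eq0 -qadd addrC subrr q0.
have qlin a x y : q (a *: x + y) = a * q x + q y.
  rewrite qadd; congr (_ + _); have [a0|/ltW a0] := leP 0 a; first exact: qZ.
  by rewrite -[a]opprK scaleNr qN qZ ?oppr_ge0// [RHS]mulNr.
have qle x : q x <= `|x| by exact: le_trans (qp' x) (p'p x).
have qabs x : `|q x| <= 1 * `|x|.
  by rewrite mul1r ler_norml qle andbT lerNl -qN -(normrN x) qle.
have [f fq] := bounded_linear_dual qlin qabs.
exists f; first by apply: dual_bound_le => // x; rewrite fq.
rewrite fq; apply/eqP; rewrite eq_le qle/= -[q x0]opprK lerNr -qN.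
by apply: le_trans (qp' _) (le_trans (p'x0 _) _); rewrite addNr normr0 sub0r.
Qed.
End functionals.

(** The limit is the supremum of the [r] with [r <= h i] for [U]-almost all [i]. *)
Lemma ultra_bounded_cvg (R : realType) (I : Type) (U : set_system I)
    (h : I -> R) (C : R) : UltraFilter U ->
  (forall i, `|h i| <= C) -> exists l : R, h i @[i --> U] --> l.
Proof.
move=> UU hC; pose S := [set r | U [set i | r <= h i]].
have hge i : - C <= h i by have := hC i; rewrite ler_norml => /andP[].
have hle i : h i <= C by have := hC i; rewrite ler_norml => /andP[].
have Ssup : has_sup S.
  split; first by exists (- C); apply: filterE.
  exists C => r Ur; have [i /= ri] := filter_ex Ur.
  exact: le_trans ri (hle i).
exists (sup S); apply/cvgrPdist_lt => e e0.
have [r Sr er] := sup_adherent e0 Ssup.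
have [Se|] := in_ultra_setVsetC [set i | sup S + e / 2 <= h i] UU.
  have := ub_le_sup Ssup.2 Se.
  by rewrite gerDl leNgt divr_gt0.
move: Sr; apply: filterS2 => i /= ri /negP; rewrite -ltNge => hi.
rewrite ltr_distlC; apply/andP; split; first exact: lt_le_trans er ri.
by apply: lt_trans hi _; rewrite ltrD2l ltr_pdivrMr// ltr_pMr// ltr1n.
Qed.

Lemma history_choice T (P : seq T -> T -> Prop) : (forall s, exists t, P s t) ->
  exists u : nat -> T, forall n, P (mkseq u n) (u n).
Proof.
move=> /choice[next nextP].
pose hist n := iter n (fun s => rcons s (next s)) [::].
exists (fun n => next (hist n)) => n.
suff -> : mkseq (fun n => next (hist n)) n = hist n by [].
by elim: n => // n IHn; rewrite mkseqS IHn.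
Qed.

(** * The bidual and James' sequences *)

Section bidual.
Variables (R : realType) (X : normedModType R).

Lemma ex_evaluation (x : X) : exists phi : dual (dual X), forall f : dual X,
  phi f = f x.
Proof.
apply: (@bounded_linear_dual R (dual X) (fun f : dual X => f x) `|x|) => // f.
by rewrite mulrC; exact: dual_norm_ub.
Qed.

Definition evaluation (x : X) : dual (dual X) := sval (cid (ex_evaluation x)).

Lemma evaluationE x (f : dual X) : evaluation x f = f x.
Proof. by rewrite /evaluation; case: cid. Qed.


End bidual.

Section James.
Variables (R : realType) (X : completeNormedModType R).
Hypothesis X_nonreflexive : ~ reflexive_space X.

(** Otherwise some [Phi] outside the image of [X] is a norm limit of evaluations at points [x n]. By
    [norming_dual] these points form a Cauchy sequence, and [Phi] is the evaluation at its limit. *)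
Lemma nonreflexive_dist : exists (Phi : dual (dual X)) (d : R),
  0 < d /\ forall x, d <= `|Phi - evaluation x|.
Proof.
have /existsNP[Phi /forallNP Phin] := X_nonreflexive.
exists Phi; apply: contrapT => /forallNP nod.
have /choice[x xP] : forall n : nat, exists x,
  `|Phi - evaluation x| < n.+1%:R^-1.
  move=> n; apply: contrapT => /forallNP nx; apply: (nod n.+1%:R^-1);
    split=> [|x]; first by rewrite invr_gt0.
  by rewrite leNgt; apply/negP/nx.
have le_inv (e : R) : 0 < e -> \forall n \near \oo, n.+1%:R^-1 < e.
  move=> e0; have := @cvg_harmonic R => /cvgrPdist_lt/(_ _ e0).
  by apply: filterS => n; rewrite /harmonic/= sub0r normrN ger0_norm// invr_ge0.
have xdist m n : `|x m - x n| <= m.+1%:R^-1 + n.+1%:R^-1.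
  have [f f1 <-] := norming_dual (x m - x n).
  have -> : f (x m - x n) = - (Phi - evaluation (x m)) f + (Phi - evaluation (x
    n)) f.
    rewrite -[(Phi - _) f]/(Phi f - evaluation _ f) -[(Phi - evaluation (x n))
      f]/(Phi f - evaluation _ f).
    by rewrite !evaluationE linearB/= opprB addrA subrK.
  apply: le_trans (ler_norm _) _; apply: le_trans (ler_normD _ _) _.
  rewrite normrN lerD//; apply: le_trans (ler_norm_dual _ _) _.
    by apply: le_trans (ltW (xP m)); rewrite ler_piMr// dual_norm_ge0.
  by apply: le_trans (ltW (xP n)); rewrite ler_piMr// dual_norm_ge0.
have /cauchy_cvgP/cvg_ex[l xl] : cauchy (x @ \oo).
  apply/cauchy_exP => e e0;
    have [N _ Ne] := le_inv _ (divr_gt0 e0 (ltr0Sn _ 1)).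
  exists (x N); exists N => // n /= Nn; rewrite -ball_normE/=.
  apply: le_lt_trans (xdist _ _) _; rewrite [e]splitr.
  by apply: ltrD; apply: Ne => /=.
apply: (Phin l) => f.
have fl : f (x n) @[n --> \oo] --> (f l : R^o).
  by apply: continuous_cvg => //; exact: dual_continuous.
apply: (cvg_unique _ _ fl) => //.
apply/cvgrPdist_lt => e e0.
have f0 : 0 < `|f| + 1 by rewrite ltr_wpDl.
have := le_inv _ (divr_gt0 e0 f0); apply: filterS => n ne.
have -> : Phi f - f (x n) = (Phi - evaluation (x n)) f.
  by rewrite -[RHS]/(Phi f - evaluation _ f) evaluationE.
apply: le_lt_trans (ler_norm_dual _ _) _.
rewrite -[ltRHS](divfK (lt0r_neq0 f0)).
apply: (@le_lt_trans _ _ (`|Phi - evaluation (x n)| * (`|f| + 1))).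
  by rewrite ler_wpM2l ?dual_norm_ge0// lerDl.
by rewrite ltr_pM2r//; exact: lt_trans (xP n) ne.
Qed.

(* With [Phi] in the bidual away from [X], [helly] in the dual yields [f n] small
   at the earlier [x k] with [Phi (f n)] close to [1], and [helly] in [X] yields
   [x n] with [f i (x n)] close to [Phi (f i)] for all [i <= n]. *)
Lemma James_sequences : exists (C : R) (f : nat -> dual X) (x : nat -> X),
  [/\ 0 < C, forall n, `|f n| <= C, forall n, `|x n| <= C,
    forall i k, (i <= k)%N -> 2^-1 <= f i (x k) &
    forall k n, (k < n)%N -> `|f n (x k)| <= 4^-1].
Proof.
have [Phi [d [d0 Phid]]] := nonreflexive_dist.
have q0 : 0 < 4^-1 :> R by rewrite invr_gt0.
pose M := `|Phi| + 1; pose C := Num.max d^-1 M.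
have M0 : 0 < M by rewrite ltr_wpDl.
pose P (s : seq (dual X * X)) (p : dual X * X) :=
  [/\ `|p.1| <= C, `|p.2| <= C, forall q, q \in s -> `|p.1 q.2| <= 4^-1,
    `|Phi p.1 - 1| <= 4^-1 &
    forall q, q \in p :: s -> `|q.1 p.2 - Phi q.1| <= 4^-1].
have [s|u uP] := @history_choice _ P.
  pose l (i : 'I_(size s).+1) : dual (dual X) :=
    if unlift ord0 i is Some j then evaluation (nth (0, 0) s j).2 else Phi.
  pose c (i : 'I_(size s).+1) : R := if unlift ord0 i is Some j then 0 else 1.
  (* Any combination of [Phi] and evaluations in which [Phi] has coefficient [a0 > 0] has norm at
     least [a0 * d]. This is the hypothesis of [helly] with radius [d^-1]. *)
  have [|a|f fC fl] := @helly R (dual X) _ l c d^-1 _ _ _ q0.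
  - by rewrite invr_gt0.
  - rewrite mulrC ler_pdivlMr// !big_ord_recl/= /l /c !unlift_none mulr1.
    under eq_bigr do rewrite liftK mulr0.
    under [in leRHS]eq_bigr do rewrite liftK.
    rewrite big1// addr0; have [a0|a0] := ltP 0 (a ord0); last first.
      by apply: le_trans (dual_norm_ge0 _); rewrite mulr_le0_ge0// ltW.
    set z := \sum_i a (lift ord0 i) *: (nth (0, 0) s i).2.
    have -> : \sum_(i < size s) a (lift ord0 i) *: evaluation (nth (0,
      0) s i).2 = evaluation z.
      apply: dual_ext => g; rewrite evaluationE dualE_sum /z linear_sum.
      by apply: eq_bigr => i _; rewrite evaluationE linearZ.
    have -> : a ord0 *: Phi + evaluation z =
        a ord0 *: (Phi - evaluation (- (a ord0)^-1 *: z)).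
      apply: dual_ext => g; rewrite -[LHS]/(a ord0 * Phi g + evaluation z g).
      rewrite -[RHS]/(a ord0 * (Phi g - evaluation _ g)) !evaluationE.
      rewrite linearZ/= -[_ *: g z]/(_ * g z) mulrBr mulNr mulrN opprK mulrA
        divff ?mul1r//.
      exact: lt0r_neq0.
    by rewrite normrZ gtr0_norm// ler_pM2l.
  (* Here the targets are values of [Phi], so a radius above the norm of [Phi] suffices. *)
  have [a|x xC xl] := @helly R X (size s).+1
      (fun i => if unlift ord0 i is Some j then (nth (0, 0) s j).1 else f)
      (fun i => Phi (if unlift ord0 i is Some j then (nth (0,
        0) s j).1 else f)) M M0 _ _ q0.
  - rewrite (_ : \sum_i _ = Phi (\sum_i a i *: (if unlift ord0 i is Some j then
    (nth (0, 0) s j).1 else f))).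
      apply: le_trans (ler_norm _) _; apply: le_trans (ler_norm_dual _ _) _.
      by rewrite ler_wpM2r// /M lerDl.
    by rewrite linear_sum; apply: eq_bigr => i _; rewrite linearZ.
  exists (f, x); split => /=.
  - by rewrite /C le_max fC.
  - by rewrite /C le_max xC orbT.
  - move=> q /(nthP (0, 0))[j js <-].
    have := fl (lift ord0 (Ordinal js));
      rewrite /l /c liftK/= evaluationE subr0.
    exact: ltW.
  - by have := fl ord0; rewrite /l /c unlift_none => /ltW.
  - move=> q; rewrite inE => /predU1P[->|/(nthP (0, 0))[j js <-]].
      by have := xl ord0; rewrite unlift_none => /ltW.
    by have := xl (lift ord0 (Ordinal js)); rewrite liftK => /ltW.
exists C, (fun n => (u n).1), (fun n => (u n).2); split.
- by rewrite /C lt_max M0 orbT.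
- by move=> n; have [] := uP n.
- by move=> n; have [] := uP n.
- move=> i k ik; have [_ _ _ Phi1 _] := uP i; have [_ _ _ _ /(_ (u i))] := uP k.
  have -> : u i \in u k :: mkseq u k.
    move: ik; rewrite leq_eqVlt inE => /predU1P[->|ik]; first by rewrite eqxx.
    by apply/orP; right; apply/mapP; exists i; rewrite // mem_iota.
  (* [f i (x k)] is within [1/4] of [Phi (f i)], which is within [1/4] of 1. *)
  move=> /(_ isT); move: Phi1; rewrite !ler_norml => /andP[? _] /andP[? _]; lra.
- move=> k n kn; have [_ _ + _ _] := uP n; apply.
  by apply/mapP; exists k; rewrite // mem_iota.
Qed.

(* A weak* limit would give a weak limit [g]; a cluster point [Psi] of [x] in the
   bidual would then satisfy both [Psi g <= 1/4] and [Psi g >= 1/2]. *)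
Lemma no_weak_star_limit (C : R) (x : nat -> X) (u : nat -> dual X) :
  grothendieck_space X -> 0 < C ->
  (forall k, `|x k| <= C) -> (forall j, `|u j| <= C) ->
  (forall j, \forall k \near \oo, 2^-1 <= u j (x k)) ->
  (forall k, \forall j \near \oo, `|u j (x k)| <= 4^-1) ->
  exists y : X, forall l : R, ~ (u j y @[j --> \oo] --> l).
Proof.
move=> grX C0 xC uC uhigh ulow; apply: contrapT => /forallNP ncvg.
have [|j y|y|f uf] := @lim_dual R X nat \oo (fun j y => u j y) C _.
- by move=> j a y z; rewrite linearP.
- by apply: le_trans (ler_norm_dual _ _) _; rewrite ler_wpM2r.
- by have /existsNP[l /contrapT ul] := ncvg y; exists l.
have [g ug] : exists g, weak_cvg u g by apply/grX; exists f.
have [U [UU oU]] := @ultraFilterLemma _ (\oo : set_system nat) _.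
have hC k (h : dual X) : `|h (x k)| <= C * `|h|.
  by apply: le_trans (ler_norm_dual _ _) _; rewrite mulrC ler_wpM2r.
have [k a h1 h2|h|Psi PsiU] :=
  @lim_dual R (dual X) nat U (fun k h => h (x k)) C _ _ hC.
- by [].
- exact: (@ultra_bounded_cvg _ _ _ _ (C * `|h|) UU).
have Psig : Psi g <= 4^-1.
  apply: (cvgr_to_le (PsiU g)); apply: nearW => k.
  have := ug (evaluation (x k)); rewrite evaluationE.
  under eq_fun do rewrite evaluationE.
  move=> uxk; apply: (cvgr_to_le uxk).
  by apply: filterS (ulow k) => j; exact/le_trans/ler_norm.
have : 2^-1 <= Psi g.
  apply: (cvgr_to_ge (ug Psi)); apply: nearW => j.
  apply: (cvgr_to_ge (PsiU (u j))); apply: oU; exact: uhigh.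
lra.
Qed.
End James.

(** * Point-countable families of functionals *)

(* A tree stands for the dyadic probability measure on [nat] obtained by averaging
   the two measures at each node. *)
Inductive tree := Leaf of nat | Node of tree & tree.

Fixpoint leaves t : seq nat :=
  match t with Leaf n => [:: n] | Node s t => leaves s ++ leaves t end.

Section mean.
Variable R : realType.
Implicit Types phi psi : nat -> R.

Fixpoint mean phi t : R :=
  match t with Leaf n => phi n | Node s t => (mean phi s + mean phi t) / 2 end.

Lemma mean_ext phi psi t : (forall n, n \in leaves t -> phi n = psi n) ->
  mean phi t = mean psi t.
Proof.
elim: t => [n|s IHs t IHt] /= h; first by apply: h; rewrite inE.
by rewrite IHs ?IHt// => n nt; apply: h; rewrite mem_cat nt ?orbT.
Qed.

Lemma meanP a phi psi t :
  mean (fun n => a * phi n + psi n) t = a * mean phi t + mean psi t.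
Proof. by elim: t => //= s -> t ->; lra. Qed.

Lemma mean_cst c t : mean (fun=> c) t = c.
Proof. by elim: t => //= s -> t ->; lra. Qed.

Lemma ler_mean phi psi t : (forall n, n \in leaves t -> phi n <= psi n) ->
  mean phi t <= mean psi t.
Proof.
elim: t => [n|s IHs t IHt] /= h; first by apply: h; rewrite inE.
by rewrite ler_pM2r ?invr_gt0//; apply: lerD; [apply: IHs|apply: IHt] => n nt;
  apply: h; rewrite mem_cat nt ?orbT.
Qed.

Lemma meanZ a phi t : mean (fun n => a * phi n) t = a * mean phi t.
Proof. by elim: t => //= s -> t ->; lra. Qed.

Lemma mean_mulC phi psi t :
  mean (fun n => phi n * psi n) t = mean (fun n => psi n * phi n) t.
Proof. by apply: mean_ext => n _; rewrite mulrC. Qed.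

Lemma mean_bound phi C t : (forall n, `|phi n| <= C) -> `|mean phi t| <= C.
Proof.
move=> phiC; rewrite ler_norml -{1}(mean_cst (- C) t) -{2}(mean_cst C t).
by rewrite !ler_mean// => n _; have := phiC n; rewrite ler_norml => /andP[].
Qed.

(* The sign [b] covers the case where the sequence only stays away from its
   cluster value from below. *)
Lemma oscillation (a : nat -> R) (C : R) : (forall j, `|a j| <= C) ->
  (forall l : R, ~ (a j @[j --> \oo] --> l)) ->
  exists (b : bool) (l e : R), 0 < e /\ forall N : nat,
    (exists2 j, (N <= j)%N & l + e <= (-1) ^+ b * a j) /\
    (exists2 j, (N <= j)%N & (-1) ^+ b * a j <= l + e / 2).
Proof.
move=> aC ncvg; have [U [UU oU]] :=
  @ultraFilterLemma _ (\oo : set_system nat) _.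
have [l al] := ultra_bounded_cvg UU aC.
have [e [e0 far]] : exists e : R, 0 < e /\
  forall N : nat, exists2 j, (N <= j)%N & e <= `|l - a j|.
  apply: contrapT => /forallNP nfar; apply: (ncvg l).
  apply/cvgrPdist_lt => e e0; apply: contrapT => ne; apply: (nfar e);
    split=> // N.
  apply: contrapT => nj; apply: ne; exists N => // j /= Nj.
  by rewrite ltNge; apply/negP => ej; apply: nj; exists j.
have near N : exists2 j, (N <= j)%N & `|l - a j| < e / 2.
  have /cvgrPdist_lt/(_ _ (divr_gt0 e0 (ltr0Sn _ 1))) Ul := al.
  have UN : U [set j | (N <= j)%N] by apply: oU; exists N.
  by have [j [/= ? ?]] := filter_ex (filterI Ul UN); exists j.
have [up|/existsNP[N0 nN0]] :=
  pselect (forall N : nat, exists2 j, (N <= j)%N & l + e <= a j).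
  exists false, l, e; split=> // N; split.
    by have [j Nj la] := up N; exists j; rewrite // expr0 mul1r.
  have [j Nj lj] := near N; exists j => //; rewrite expr0 mul1r.
  by move: lj; rewrite ltr_norml => /andP[]; lra.
exists true, (- l), e; split=> // N; split.
  have [j] := far (maxn N N0); rewrite geq_max => /andP[Nj N0j] ej.
  exists j => //; rewrite expr1 mulN1r.
  have aj : a j < l + e.
    by rewrite ltNge; apply/negP => laj; apply: nN0; exists j.
  by move: ej; rewrite ler_normr => /orP[]; lra.
have [j Nj lj] := near N; exists j => //; rewrite expr1 mulN1r.
by move: lj; rewrite ltr_norml => /andP[]; lra.
Qed.

End mean.

(** * A maximal Rademacher-like family *)

Section rademacher.
Variables (R : realType) (X : normedModType R) (f : nat -> dual X) (C : R).
Hypothesis fC : forall n, `|f n| <= C.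
Hypothesis fdiv : forall t : nat -> tree, (forall j n, n \in leaves (t j) ->
  (j <= n)%N) ->
  exists y, forall l : R, ~ (mean (fun n => f n y) (t j) @[j --> \oo] --> l).

Let T := ((nat -> R) * X)%type.
Implicit Types (p q : T) (F G : set T).

(* A pair [(r, x)] consists of a Rademacher-like function [r] on [nat] and a vector
   [x] such that [r] correlates with the sequence [f n x]. *)
Definition approx F (e : R) (N : nat) (t : tree) :=
  [/\ forall n, n \in leaves t -> (N <= n)%N,
    forall p, F p -> `|mean p.1 t| < e,
    forall p, F p -> 1 <= mean (fun n => p.1 n * f n p.2) t &
    forall p q, F p -> F q -> p <> q -> `|mean (fun n => p.1 n * q.1 n) t| < e].

(** Approximation is asked for finite subfamilies only, so admissibility passes to unions of chains.
    The free bound [N] lets the measures be moved arbitrarily far out. *)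
Definition admissible G := (forall p, G p -> forall n, `|p.1 n| <= 1) /\
  forall F e N, finite_set F -> F `<=` G -> 0 < e -> exists t, approx F e N t.

Lemma finite_sub_chain (A : Type) (D : set (set A)) (F : set A) : finite_set F
  ->
  total_on D subset -> D !=set0 -> F `<=` \bigcup_(Y in D) Y ->
  exists2 Y, D Y & F `<=` Y.
Proof.
(* [Peq] makes [A] an [eqType], for membership in sequences. *)
move=> + Dtot [Y0 DY0]; elim/Peq : A => A in D F Dtot Y0 DY0 *.
move=> /finite_seqP[s ->]; elim: s => [|a s IHs] sD; first by exists Y0.
have [|Y DY sY] := IHs; first by move=> b /= bs; apply: sD;
  rewrite /= inE bs orbT.
have [|Z DZ Za] := sD a; first by rewrite /= mem_head.
have [YZ|ZY] := Dtot _ _ DY DZ.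
  exists Z => // b /=; rewrite inE => /predU1P[->//|bs]; apply: YZ; exact: sY.
exists Y => // b /=; rewrite inE => /predU1P[->|/sY//]; exact: ZY.
Qed.

Lemma ex_maximal_admissible : exists G, admissible G /\
  forall G', G `<` G' -> ~ admissible G'.
Proof.
apply: Zorn_bigcup => D DP Dtot; split.
  by move=> p [Y DY Yp]; have [/(_ _ Yp)] := DP _ DY.
move=> F e N Ffin FD e0; have [Dn0|/nonemptyPn D0] := pselect (D !=set0).
  have [Y DY FY] := finite_sub_chain Ffin Dtot Dn0 FD.
  by have [_ /(_ F e N Ffin FY e0)] := DP _ DY.
(* For the empty chain [F] is empty, and the point mass at [N] will do. *)
exists (Leaf N); rewrite D0 bigcup_set0 subset0 in FD; rewrite FD.
by split=> // n; rewrite inE => /eqP ->.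
Qed.


(** A diagonal choice along an enumeration [i] of [G]: the block [t j] serves the members of index
    below [j]. As the blocks are successive, a new function can be prescribed on each of them
    separately. *)
Lemma approx_blocks G : admissible G -> countable G ->
  exists (i : T -> nat) (t : nat -> tree),
    forall j, approx [set p | G p /\ (i p < j)%N] j.+1%:R^-1 j (t j) /\
    forall k m n, (k < j)%N -> m \in leaves (t k) -> n \in leaves (t j) ->
      (m < n)%N.
Proof.
move=> [_ Gapprox] /(card_le_fun 0%N)[i [_ iinj]]; exists i.
pose P (s : seq tree) t := let j := size s in
  approx [set p | G p /\ (i p < j)%N] j.+1%:R^-1 j t /\
  forall k m n, (k < j)%N -> m \in leaves (nth (Leaf 0) s k) ->
    n \in leaves t -> (m < n)%N.
have [s|t tP] := @history_choice _ P; last first.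
  exists t => j; have := tP j; rewrite /P size_mkseq => -[ap lt];
    split=> // k m n kj.
  by have := lt k m n kj; rewrite nth_mkseq.
(* A bound for all leaves of the earlier trees. *)
pose B := \max_(k < size s) \max_(m <- leaves (nth (Leaf 0) s k)) m.
have [|||t [tN t1 t2 t3]] :=
  Gapprox [set p | G p /\
  (i p < size s)%N] (size s).+1%:R^-1 (maxn (size s) B.+1).
- apply: (@card_le_finite _ _ _ `I_(size s)) => //; apply/card_le_relP.
  exists (fun p n => i p = n); split; first by move=> p [_ ip]; exists (i p).
  by move=> p q n [Gp _] [Gq _] _ <- /esym; exact: iinj.
- by move=> p [].
- by rewrite invr_gt0.
exists t; split; first by split=> // n /tN; rewrite geq_max => /andP[].
move=> k m n ks mk /tN; rewrite geq_max => /andP[_]; apply: leq_trans;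
  rewrite ltnS.
apply: leq_trans (leq_bigmax (Ordinal ks)) => /=.
exact: (@leq_bigmax_seq _ _ xpredT id).
Qed.

(** The new [r] is constant on every high or low block. Against [r], a member of [G] thus has, up to
    sign, its own mean on such a block, which is small, while [r] itself averages to zero over a
    high and a low block together. *)
Lemma admissible_extend G : admissible G -> countable G ->
  exists2 p, ~ G p & admissible (G `|` [set p]).
Proof.
move=> Gadm Gcount; have [G1 _] := Gadm.
have [i [t tP]] := approx_blocks Gadm Gcount.
have disj k j n : n \in leaves (t k) -> n \in leaves (t j) -> k = j.
  move=> nk nj; apply: contrapT => /eqP; rewrite neq_ltn => /orP[] kj.
    by have [_ /(_ _ _ _ kj nk nj)] := tP j; rewrite ltnn.
  by have [_ /(_ _ _ _ kj nj nk)] := tP k; rewrite ltnn.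
have [y0 ncvg] := fdiv (fun j n nj => let: And4 h _ _ _ := (tP j).1 in h n nj).
have aC j : `|mean (fun n => f n y0) (t j)| <= C * `|y0|.
  apply: mean_bound => n; apply: le_trans (ler_norm_dual _ _) _.
  by rewrite ler_wpM2r.
have [b [l [e [e0 osc]]]] := oscillation aC ncvg.
pose y := (-1) ^+ b *: y0; pose a j := mean (fun n => f n y) (t j).
have aE j : a j = (-1) ^+ b * mean (fun n => f n y0) (t j).
  by rewrite /a -meanZ; apply: mean_ext => n _; rewrite linearZ.
have {}osc N : (exists2 j, (N <= j)%N & l + e <= a j) /\
    (exists2 j, (N <= j)%N & a j <= l + e / 2).
  by have [[j Nj aj] [k Nk ak]] := osc N; split; [exists j|exists k];
    rewrite ?aE.
pose r n : R := if `[< exists j, l + e <= a j /\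
  n \in leaves (t j) >] then 1 else -1.
have r1 j n : l + e <= a j -> n \in leaves (t j) -> r n = 1.
  by move=> aj nj; rewrite /r ifT//; apply/asboolP; exists j.
have rN1 j n : a j <= l + e / 2 -> n \in leaves (t j) -> r n = -1.
  move=> aj nj; rewrite /r ifF//; apply/asboolP => -[k [ak nk]].
  by move: ak; rewrite (disj _ _ _ nk nj); lra.
(* High and low means of [y] differ by at least [e / 2], and averaging two blocks halves the
   difference. The factor [4 / e] restores the value 1. *)
pose x := (4 / e) *: y; pose p0 : T := (r, x).
exists p0.
  (* On a late high block [r] has mean 1, whereas a member of [G] would have mean below
     [j.+1%:R^-1]. *)
  move=> Gp0; have [[j ij aj] _] := osc (i p0).+1.
  have [[_ /(_ p0)/= rj _ _] _] := tP j; move: rj.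
  rewrite (@mean_ext _ _ (fun=> 1)); last by move=> n; exact: r1.
  rewrite mean_cst normr1 => /(_ (conj Gp0 ij)); apply/negP; rewrite -leNgt.
  by rewrite invf_le1// ler1n.
split=> [p [/G1//|->] n|F d N Ffin FG d0].
  by rewrite /p0/= /r; case: ifP; rewrite ?normrN normr1.
have [k Fk] : exists k, forall p, F p -> (i p < k)%N.
  have /finite_seqP[s ->] := Ffin; exists (\max_(p <- s) i p).+1 => p /= ps.
  by rewrite ltnS; exact: (@leq_bigmax_seq _ _ xpredT i).
have [M Md] : exists M : nat, forall j, (M <= j)%N -> j.+1%:R^-1 < d.
  have := @cvg_harmonic R => /cvgrPdist_lt/(_ _ d0)[M _ Md].
  exists M => j /Md; rewrite /harmonic/= sub0r normrN ger0_norm// invr_ge0.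
  by rewrite ler0n.
have [[j + aj] [j' + aj']] := osc (maxn k (maxn N M)).
rewrite !geq_max => /and3P[kj Nj Mj] /and3P[kj' Nj' Mj'].
have [[Lj A1 A2 A3] _] := tP j; have [[Lj' B1 B2 B3] _] := tP j'.
have inj p : F p -> G p -> G p /\ (i p < j)%N.
  by move=> Fp Gp; split=> //; exact: leq_trans (Fk _ Fp) kj.
have inj' p : F p -> G p -> G p /\ (i p < j')%N.
  by move=> Fp Gp; split=> //; exact: leq_trans (Fk _ Fp) kj'.
have half u v : `|u| < j.+1%:R^-1 -> `|v| < j'.+1%:R^-1 -> `|(u + v) / 2| < d.
  move=> /lt_trans/(_ (Md _ Mj)) + /lt_trans/(_ (Md _ Mj')).
  by rewrite !ltr_norml => /andP[? ?] /andP[? ?]; apply/andP; split; lra.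
have rm phi : mean (fun n => r n * phi n) (t j) = mean phi (t j).
  by apply: mean_ext => n nj; rewrite (r1 j n)// mul1r.
have rm' phi : mean (fun n => r n * phi n) (t j') = - mean phi (t j').
  by rewrite -mulN1r -meanZ; apply: mean_ext => n nj; rewrite (rN1 j' n).
exists (Node (t j) (t j')); split.
- move=> n /=; rewrite mem_cat => /orP[/Lj|/Lj'].
    exact: leq_trans.
  exact: leq_trans.
- move=> p Fp; have [Gp|pE] := FG _ Fp => /=.
    by apply: half; [apply: A1; exact: inj|apply: B1; exact: inj'].
  rewrite pE /p0/= (@mean_ext _ r (fun=> 1) (t j)); last by move=> n; exact: r1.
  rewrite (@mean_ext _ r (fun=> -1) (t j')); last by move=> n; exact: rN1.
  by rewrite !mean_cst subrr mul0r normr0.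
- move=> p Fp; have [Gp|pE] := FG _ Fp => /=.
    by have := A2 _ (inj _ Fp Gp); have := B2 _ (inj' _ Fp Gp); lra.
  rewrite pE /p0/= rm rm'.
  have xE k' : mean (fun n => f n x) (t k') = 4 / e * a k'.
    by rewrite /a -meanZ; apply: mean_ext => n _; rewrite linearZ.
  rewrite !xE (_ : _ / 2 = 2 * (a j - a j') / e); last by field;
    exact: lt0r_neq0.
  by rewrite ler_pdivlMr// mul1r; lra.
- move=> p q Fp Fq pq; have [Gp|pE] := FG _ Fp; have [Gq|qE] := FG _ Fq => /=.
  + by apply: half; [apply: A3 => //; exact: inj|apply: B3 => //; exact: inj'].
  + rewrite qE /p0/= 2!(mean_mulC p.1) rm rm'; apply: half; first by apply: A1;
    exact: inj.
    by rewrite normrN; apply: B1; exact: inj'.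
  + rewrite pE /p0/= rm rm'; apply: half; first by apply: A1; exact: inj.
    by rewrite normrN; apply: B1; exact: inj'.
  + by case: pq; rewrite pE qE.
Qed.

Lemma ex_uncountable_admissible : exists2 G, admissible G & ~ countable G.
Proof.
have [G [Gadm Gmax]] := ex_maximal_admissible; exists G => // Gcount.
have [p nGp] := admissible_extend Gadm Gcount; apply: Gmax.
by split=> [q|/(_ p)]; [left|move=> /(_ (or_intror erefl))].
Qed.


Lemma approx_ultrafilter G : admissible G -> exists U : set_system tree,
  UltraFilter U /\ forall F e, finite_set F -> F `<=` G -> 0 < e ->
    U [set t | approx F e 0 t].
Proof.
move=> [_ Gapprox].
pose B := [set A | exists F e, [/\ finite_set F, F `<=` G, 0 < e &
  [set t | approx F e 0 t] `<=` A]].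
have BF : ProperFilter B.
  split.
    move=> [F [e [Ffin FG e0 sub]]].
    by have [t Ft] := Gapprox F e 0%N Ffin FG e0; exact: (sub t).
  split.
  - by exists set0, 1; split.
  - move=> A A' [F [e [Ffin FG e0 sub]]] [F' [e' [Ffin' FG' e'0 sub']]].
    exists (F `|` F'), (Num.min e e'); split.
    + by rewrite finite_setU.
    + by move=> p [/FG|/FG'].
    + by rewrite lt_min e0.
    + move=> t [t0 t1 t2 t3]; split; [apply: sub|apply: sub']; split=> //.
      * by move=> p Fp; have := t1 p (or_introl Fp); rewrite lt_min => /andP[].
      * by move=> p Fp; apply: t2; left.
      * move=> p q Fp Fq pq; have := t3 p q (or_introl Fp) (or_introl Fq) pq.
        by rewrite lt_min => /andP[].
      * by move=> p Fp; have := t1 p (or_intror Fp); rewrite lt_min => /andP[].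
      * by move=> p Fp; apply: t2; right.
      * move=> p q Fp Fq pq; have := t3 p q (or_intror Fp) (or_intror Fq) pq.
        by rewrite lt_min => /andP[].
  - move=> A A' AA' [F [e [Ffin FG e0 sub]]]; exists F, e; split=> //.
    exact: subset_trans sub AA'.
have [U [UU BU]] := ultraFilterLemma BF.
by exists U; split=> // F e Ffin FG e0; apply: BU; exists F, e; split.
Qed.

(** * Bessel's inequality for the ultrafilter mean *)

Section Bessel.
Variables (G : set T) (U : set_system tree).
Hypothesis Gadm : admissible G.
Hypothesis UU : UltraFilter U.
Hypothesis UG : forall F e, finite_set F -> F `<=` G -> 0 < e ->
  U [set t | approx F e 0 t].

Definition bounded_seq (phi : nat -> R) := exists K, forall n, `|phi n| <= K.

Lemma ex_ultramean : exists m : (nat -> R) -> R,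
  forall phi, bounded_seq phi -> mean phi t @[t --> U] --> m phi.
Proof.
have /choice[m mP] : forall phi, exists l : R,
    bounded_seq phi -> mean phi t @[t --> U] --> l.
  (* Unbounded sequences get the default value 0. *)
  move=> phi; have [[K phiK]|nb] := pselect (bounded_seq phi); last by exists 0.
  have [t|l phil] := @ultra_bounded_cvg _ _ U (mean phi) K UU;
    first exact: mean_bound.
  by exists l.
by exists m.
Qed.

Variable m : (nat -> R) -> R.
Hypothesis mP : forall phi, bounded_seq phi -> mean phi t @[t --> U] --> m phi.

Lemma bounded_seqP a phi psi : bounded_seq phi -> bounded_seq psi ->
  bounded_seq (fun n => a * phi n + psi n).
Proof.
move=> [K phiK] [L psiL]; exists (`|a| * K + L) => n.
apply: le_trans (ler_normD _ _) _; rewrite normrM lerD//.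
by rewrite ler_wpM2l.
Qed.

Lemma bounded_seqM phi psi : bounded_seq phi -> bounded_seq psi ->
  bounded_seq (fun n => phi n * psi n).
Proof.
move=> [K phiK] [L psiL]; exists (K * L) => n.
by rewrite normrM ler_pM.
Qed.

Lemma ultrameanP a phi psi : bounded_seq phi -> bounded_seq psi ->
  m (fun n => a * phi n + psi n) = a * m phi + m psi.
Proof.
move=> bphi bpsi; apply: (cvg_unique _ (mP (bounded_seqP a bphi bpsi))) => //=.
under eq_fun do rewrite meanP.
by apply: cvgD; [apply: cvgMr; exact: mP|exact: mP].
Qed.

Lemma ultramean_ge0 phi : bounded_seq phi -> (forall n, 0 <= phi n) ->
  0 <= m phi.
Proof.
move=> bphi phi0; apply: (cvgr_to_ge (mP bphi)); apply: nearW => t.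
by rewrite -(mean_cst 0 t) ler_mean.
Qed.

Lemma G_bounded p : G p -> bounded_seq p.1.
Proof. by move=> /(Gadm.1 p) p1; exists 1. Qed.

Lemma ultramean_ortho p q : G p -> G q -> p <> q ->
  m (fun n => p.1 n * q.1 n) = 0.
Proof.
move=> Gp Gq pq; have bpq := bounded_seqM (G_bounded Gp) (G_bounded Gq).
apply: (cvg_unique _ (mP bpq)) => //; apply/cvgrPdist_lt => e e0.
have Fin : finite_set [set p; q] by exact: finite_set2.
have FG : [set p; q] `<=` G by move=> r [->|->].
apply: filterS (UG Fin FG e0) => t [_ _ _ /(_ p q)].
by rewrite sub0r normrN; apply => //; [left|right].
Qed.

Lemma ultramean_sqr p : G p -> m (fun n => p.1 n * p.1 n) <= 1.
Proof.
move=> Gp; have bp := bounded_seqM (G_bounded Gp) (G_bounded Gp).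
apply: (cvgr_to_le (mP bp)); apply: nearW => t.
rewrite -(mean_cst 1 t) ler_mean// => n _; have := Gadm.1 p Gp n.
by rewrite ler_norml => /andP[]; nra.
Qed.

(** Removing from [phi] its component along [p] leaves the coefficients at the other members
    unchanged, by orthogonality. As the mean square of [p] is at most 1, the mean square of [phi]
    drops by at least [c ^+ 2]. *)
Lemma Bessel_inequality (s : seq T) phi : uniq s -> (forall p, p \in s ->
  G p) ->
  bounded_seq phi ->
  \sum_(p <- s) m (fun n => phi n * p.1 n) ^+ 2 <= m (fun n => phi n * phi n).
Proof.
elim: s phi => [|p s IHs] phi /=.
  move=> _ _ bphi; rewrite big_nil; apply: ultramean_ge0 => [|n].
    exact: bounded_seqM.
  by rewrite -expr2 sqr_ge0.
move=> /andP[ps us] sG bphi; rewrite big_cons.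
have Gp : G p by apply: sG; rewrite mem_head.
have bp := G_bounded Gp.
set c := m (fun n => phi n * p.1 n).
pose phi' n := - c * p.1 n + phi n.
have bphi' : bounded_seq phi' by exact: bounded_seqP.
have bpp := bounded_seqM bp bp; have bphip := bounded_seqM bphi bp.
have bphi2 := bounded_seqM bphi bphi.
have mphi' : m (fun n => phi' n * phi' n) <= m (fun n =>
  phi n * phi n) - c ^+ 2.
  have -> : (fun n => phi' n * phi' n) = (fun n => c ^+ 2 * (p.1 n * p.1 n) +
      (- (2 * c) * (phi n * p.1 n) + phi n * phi n)).
    by apply/funext => n; rewrite /phi'; ring.
  rewrite !ultrameanP//; last exact: bounded_seqP.
  rewrite -/c; have := ultramean_sqr Gp; have := sqr_ge0 c; nra.
have : \sum_(q <- s) m (fun n => phi' n * q.1 n) ^+ 2 <= m (fun n =>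
  phi' n * phi' n).
  by apply: IHs => // q qs; apply: sG; rewrite inE qs orbT.
rewrite (eq_big_seq (fun q => m (fun n => phi n * q.1 n) ^+ 2)); first by lra.
move=> q qs; have Gq : G q by apply: sG; rewrite inE qs orbT.
have bq := G_bounded Gq; congr (_ ^+ 2).
have -> : (fun n => phi' n * q.1 n) = (fun n =>
  - c * (p.1 n * q.1 n) + phi n * q.1 n).
  by apply/funext => n; rewrite /phi'; ring.
rewrite ultrameanP ?ultramean_ortho ?mulr0 ?add0r//; try exact: bounded_seqM.
by move=> pq; move: ps; rewrite pq qs.
Qed.

(** By Bessel's inequality at most [M * k.+1%:R ^+ 2] members have a coefficient of modulus at least
    [k.+1%:R^-1]. *)
Lemma ultramean_countable phi : bounded_seq phi ->
  countable [set p | G p /\ m (fun n => phi n * p.1 n) != 0].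
Proof.
move=> bphi; set M := m (fun n => phi n * phi n).
pose A k := [set p | G p /\ k.+1%:R^-1 <= `|m (fun n => phi n * p.1 n)| ].
apply: (@sub_countable _ _ _ (\bigcup_k A k)).
  apply: subset_card_le => p [Gp]; rewrite -normr_gt0 => mp.
  have := @cvg_harmonic R => /cvgrPdist_lt/(_ _ mp)[k _ /(_ k (leqnn k))].
  rewrite /harmonic/= sub0r normrN ger0_norm ?invr_ge0// => kp.
  by exists k => //; split=> //; exact: ltW.
apply: bigcup_countable => // k _; apply: finite_set_countable;
  apply: contrapT => Ainf.
have M0 : 0 <= M.
  by apply: ultramean_ge0 => [|n]; [exact: bounded_seqM|rewrite -expr2 sqr_ge0].
have [B BA BN] := infinite_set_fset (Num.bound (M * k.+1%:R ^+ 2)) Ainf.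
have BG p : p \in enum_fset B -> G p by move=> /BA[].
have := Bessel_inequality (fset_uniq B) BG bphi.
apply/negP; rewrite -ltNge -/M.
apply: (@lt_le_trans _ _ (\sum_(p <- enum_fset B) k.+1%:R^-1 ^+ 2)).
  rewrite big_const_seq count_predT iter_addr_0 -[_ *+ size _]mulr_natl exprVn.
  rewrite ltr_pdivlMr ?exprn_gt0//; apply: lt_le_trans (archi_boundP _) _.
    by rewrite mulr_ge0// exprn_ge0.
  by rewrite ler_nat.
rewrite big_seq [leRHS]big_seq; apply: ler_sum => p /BA[_ kp].
rewrite -[leRHS]real_normK ?num_real// lerXn2r ?nnegrE// invr_ge0.
by [].
Qed.

Lemma ex_orthogonal_functional p : G p -> exists g : dual X,
  forall x, g x = m (fun n => f n x * p.1 n).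
Proof.
move=> Gp; have bfp x : bounded_seq (fun n => f n x * p.1 n).
  apply: bounded_seqM (G_bounded Gp); exists (C * `|x|) => n.
  by apply: le_trans (ler_norm_dual _ _) _; rewrite ler_wpM2r.
have [t a x y|t x|x|g gU] :=
  @lim_dual R X tree U (fun t x => mean (fun n => f n x * p.1 n) t) C _.
- by rewrite -meanP; apply: mean_ext => n _; rewrite linearP/= /GRing.scale/=;
  ring.
- apply: mean_bound => n; rewrite normrM -[leRHS]mulr1 ler_pM//;
  last exact: Gadm.1.
  by apply: le_trans (ler_norm_dual _ _) _; rewrite ler_wpM2r.
- by exists (m (fun n => f n x * p.1 n)); exact: mP.
by exists g => x; apply: (cvg_unique _ (gU x)) => //; exact: mP.
Qed.

Lemma ultramean_neq0 p : G p -> 1 <= m (fun n => f n p.2 * p.1 n).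
Proof.
move=> Gp; have bfp : bounded_seq (fun n => f n p.2 * p.1 n).
  apply: bounded_seqM (G_bounded Gp); exists (C * `|p.2|) => n.
  by apply: le_trans (ler_norm_dual _ _) _; rewrite ler_wpM2r.
apply: (cvgr_to_ge (mP bfp)).
have Fin : finite_set [set p] by exact: finite_set1.
have FG : [set p] `<=` G by move=> r ->.
apply: filterS (UG Fin FG ltr01) => t [_ _ /(_ p erefl) + _].
by rewrite mean_mulC.
Qed.

End Bessel.

Lemma uncountable_point_countable_family : exists (G : set T) (g : T -> dual X),
  [/\ ~ countable G, forall p, G p -> exists x, g p x != 0 &
    forall x, countable [set p | G p /\ g p x != 0]].
Proof.
have [G Gadm Gunc] := ex_uncountable_admissible.
have [U [UU UG]] := approx_ultrafilter Gadm.
have [m mP] := ex_ultramean UU.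
have /choice[g gP] : forall p, exists g : dual X, G p ->
    forall x, g x = m (fun n => f n x * p.1 n).
  move=> p; have [Gp|] := pselect (G p); last by exists 0.
  by have [g gE] := ex_orthogonal_functional Gadm UU mP Gp; exists g.
exists G, g; split=> // [p Gp|x].
  exists p.2; rewrite gP// gt_eqF//; apply: lt_le_trans ltr01 _.
  exact: (ultramean_neq0 Gadm UU UG mP).
apply: sub_countable (ultramean_countable Gadm UU UG mP (phi :=
  fun n => f n x) _).
  by apply: subset_card_le => p [Gp]; rewrite gP.
exists (C * `|x|) => n.
by apply: le_trans (ler_norm_dual _ _) _; rewrite ler_wpM2r.
Qed.

End rademacher.

(** * Functionals on a nonreflexive Grothendieck space *)

Section nonreflexive_grothendieck.
Variables (R : realType) (X : completeNormedModType R).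
Hypothesis X_nonreflexive : ~ reflexive_space X.
Hypothesis X_grothendieck : grothendieck_space X.

(** Both inequalities of James' sequences survive averaging over trees whose leaves move to
    infinity. So [no_weak_star_limit] applies to these means and supplies the divergence needed for
    the Rademacher-like family. *)
Lemma nonreflexive_grothendieck_family : exists (T : Type) (G : set T) (g : T
  -> dual X),
  [/\ ~ countable G, forall p, G p -> exists x, g p x != 0 &
    forall x, countable [set p | G p /\ g p x != 0]].
Proof.
have [C [f [x [C0 fC xC fhigh flow]]]] := James_sequences X_nonreflexive.
exists ((nat -> R) * X)%type;
  apply: (uncountable_point_countable_family fC) => t tj.
have ex_mean j : exists u : dual X, forall y, u y = mean (fun n => f n y) (t j).
  apply: (@bounded_linear_dual R X _ C) => [a y z|y].
    by rewrite -meanP; apply: mean_ext => n _; rewrite linearP.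
  by apply: mean_bound => n; apply: le_trans (ler_norm_dual _ _) _;
    rewrite ler_wpM2r.
have /choice[u uE] := ex_mean.
have [k|j|j|k|y ny] := @no_weak_star_limit R X C x u X_grothendieck C0 => //.
- apply: dual_bound_le (ltW C0) => y; rewrite uE; apply: mean_bound => n.
  by apply: le_trans (ler_norm_dual _ _) _; rewrite ler_wpM2r.
- exists (\max_(n <- leaves (t j)) n) => // k /= jk; rewrite uE.
  rewrite -(mean_cst 2^-1 (t j)) ler_mean// => n nj; apply: fhigh.
  by apply: leq_trans jk; exact: (@leq_bigmax_seq _ _ xpredT id).
- exists k.+1 => // j /= kj; rewrite uE ler_norml.
  rewrite -{1}(mean_cst (- 4^-1) (t j)) -{2}(mean_cst 4^-1 (t j)).
  by apply/andP; split; apply: ler_mean => n /tj jn;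
    have := flow k n (leq_trans kj jn); rewrite ler_norml => /andP[].
- by exists y => l; under eq_fun do rewrite -uE; exact: ny.
Qed.
End nonreflexive_grothendieck.

(** Were this part of [Y] as large as [Y], its span would be dense, yet it lies in the kernel of [g]
    and misses the nonempty open set where [g] is nonzero. *)
Lemma overcomplete_kernel (R : realType) (X : normedModType R) (Y : set X) (g :
  dual X) :
  overcomplete Y -> (exists x, g x != 0) -> [set y | Y y /\ g y = 0] #< Y.
Proof.
move=> [_ Yover] [x gx]; split; first by apply: subset_card_le => y [].
apply/negP => /(Yover _ (fun y => @proj1 _ _)) dZ.
pose O := [set y : X | g y != 0].
have oO : open O.
  have -> : O = (g : X -> R^o) @^-1` (~` [set 0]).
    by apply/seteqP; split => y /= /eqP.
  apply: open_comp; first by move=> y _; exact: dual_continuous.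
  exact/closed_openC/closed_eq.
have [z [/eqP Oz [n [a [s [sZ zE]]]]]] := dZ O (ex_intro _ x gx) oO.
apply: Oz; rewrite zE linear_sum big1// => i _.
by rewrite linearZ /= (sZ i).2 scaler0.
Qed.

Theorem theorem39 (kappa : cardinal) (kappa_cf : omega1 #< cf kappa)
    (R : realType) (X : completeNormedModType R)
    (X_infdim : infinite_dimensional X)
    (X_nonreflexive : ~ reflexive_space X)
    (X_grothendieck : grothendieck_space X)
    (X_dens : dens X #= [set: kappa]) :
  ~ exists Y : set X, overcomplete Y.
Proof.
move=> [Y Yover]; have [T [G [g [Gunc g0 gcount]]]] :=
  nonreflexive_grothendieck_family X_nonreflexive X_grothendieck.
have Yk : Y #= [set: kappa] by case: Yover => Ydens _;
  exact: card_eq_trans Ydens X_dens.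
have [kY Yk'] : [set: kappa] #<= Y /\ Y #<= [set: kappa].
  by move: Yk => /card_eqPle[].
have w1inf : infinite_set omega1.
  by move=> /finite_set_countable; exact: omega1_uncountable.
have [p0 _] : G !=set0 by apply/set0P/eqP => G0; apply: Gunc; rewrite G0.
have /(card_le_fun p0)[h [hG hinj]] := omega1_le Gunc.
pose A i := [set y | Y y /\ g (h i) y = 0].
have Ak i : omega1 i -> A i #< [set: kappa].
  move=> wi; apply: card_lt_trans Yk'; apply: overcomplete_kernel => //.
  exact/g0/hG.
have := card_lt_cf_bigcup w1inf kappa_cf Ak.
move=> /card_ltNge; apply; apply: (card_le_trans kY).
(* If [y] lies in no kernel, then [h] embeds [omega1] into the countable set of members of [G] whose
   functional is nonzero at [y]. *)
apply: subset_card_le => y Yy; apply: contrapT => nAy.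
apply: omega1_uncountable; apply: sub_countable (gcount y).
apply/card_le_relP; exists (fun i p => h i = p); split.
  move=> i wi; exists (h i) => //; split; first exact: hG.
  by apply/eqP => gy; apply: nAy; exists i.
by move=> i j p wi wj _ <- /esym; exact: hinj.
Qed.
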